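(* Using the order $<_1$ on $\mathcal A$, \[ C_\lambda[X(t-1);q,t]=\sum_{\sigma}(-1)^{m(\sigma)}q^{\mathrm{maj}(\sigma)}t^{p(\sigma)+\mathrm{quinv}(\sigma)}x^{|\sigma|}, \] where the sum runs over all super fillings $\sigma$ of $\mathrm{dg}(\lambda)$ in which no attacking pair of cells $u,v$ has $|\sigma(u)|=|\sigma(v)|$. Moreover $C_\lambda[X(t-1);q,t]=\sum_{\mu\le\lambda}c_{\mu\lambda}(q,t)\,m_\mu(X)$ for some $c_{\mu\lambda}(q,t)\in\mathbb Q(q,t)$, where $\le$ is dominance order and $m_\mu$ are monomial symmetric functions.
   Context: Let $\lambda=(\lambda_1\ge\dots\ge\lambda_k>0)$ be a partition; $\mathrm{dg}(\lambda)=\{(r,i):1\le i\le k,1\le r\le\lambda_i\}$, $(r,i)$ being row $r$ from the bottom and column $i$ from the left (columns bottom-justified of heights $\lambda_i$); $\mathrm{leg}((r,i))=\lambda_i-r$. $C_\lambda(X;q,t)=\sum_\sigma q^{\mathrm{maj}(\sigma)}t^{\mathrm{quinv}(\sigma)}x^\sigma$ over fillings $\sigma:\mathrm{dg}(\lambda)\to\mathbb Z_{>0}$ (the special case of the super-filling statistics below with all entries positive); it is a symmetric function, and $f[X(t-1)]$ denotes the plethysm sending power sums $p_m(X)\mapsto(t^m-1)p_m(X)$. Super fillings: $\mathcal A=\{1,\bar1,2,\bar2,\dots\}$ consists of positive letters $i$ and negative letters $\bar i$, with $|i|=|\bar i|=i$. The total order $<_1$ on $\mathcal A\cup\{0\}$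 is $0<1<\bar1<2<\bar2<\cdots$ (and $<_2$ is $0<1<2<3<\cdots<\bar3<\bar2<\bar1$). For the chosen order, $I(a,b)=1$ if $a>b$ or $a=b$ is negative, and $I(a,b)=0$ if $a<b$ or $a=b$ is positive. A super filling is a map $\sigma:\mathrm{dg}(\lambda)\to\mathcal A$. A cell $u=(r,i)$ with $r>1$ is a descent if $I(\sigma(u),\sigma((r-1,i)))=1$, and $\mathrm{maj}(\sigma)=\sum_{\text{descents }u}(\mathrm{leg}(u)+1)$. A triple is either three cells $(r+1,i),(r,i),(r,j)$ with $i<j$, or (degenerate) two cells $(r,i),(r,j)$ with $i<j$ and $\lambda_i=r$; with $a=\sigma((r+1,i))$ ($a=0$ if degenerate), $b=\sigma((r,i))$, $c=\sigma((r,j))$, it is a quinv triple iff exactly one of the three conditions $I(a,b)=1$, $I(c,b)=0$, $I(a,c)=0$ holds; $\mathrm{quinv}(\sigma)$ is the number of quinv triples. $|\sigma|$ is the filling $u\mapsto|\sigma(u)|$, $x^{|\sigma|}=\prod_u x_{|\sigma(u)|}$, and $p(\sigma)$, $m(\sigma)$ are the numbers of cells with positive, resp. negative, entries. Two distinct cells $(r,i)$ and $(r',j)$ with $i<j$ form an attacking pair if $r=r'$ or $r=r'+1$. *)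

(* Defs.v *)
From HB Require Import structures.
From mathcomp Require Import all_boot all_order all_algebra.
From mathcomp Require Import fraction.
From mathcomp Require Import mpoly.
Set Implicit Arguments. Unset Strict Implicit. Unset Printing Implicit Defensive.
Import GRing.Theory.
Local Open Scope ring_scope.

Definition Qqt : fieldType := {fraction {mpoly rat[2]}}.
Definition qq : Qqt := @FracField.tofrac {mpoly rat[2]} ('X_(0 : 'I_2)).
Definition tt_ : Qqt := @FracField.tofrac {mpoly rat[2]} ('X_(1 : 'I_2)).
Definition is_partition (la : seq nat) : bool :=
  sorted geq la && all (fun x => 0 < x)%N la.
Definition is_partition_of (d : nat) (mu : seq nat) : bool :=
  is_partition mu && (sumn mu == d).
Definition dominated (mu la : seq nat) : bool :=
  (sumn mu == sumn la) &&
  all (fun i => sumn (take i mu) <= sumn (take i la))%N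
      (iota 0 (size mu + size la).+1).

(* Letters of the super alphabet.  A letter is a pair (n, b) with      *)
(* |letter| = n >= 1 and b = true iff it is negative (n bar);          *)
(* the extra letter 0 is encoded as (0, false).                        *)
Definition letter := (nat * bool)%type.
Definition zero_letter : letter := (0%N, false).
Definition lt1 (a b : letter) : bool :=
  (a.1 < b.1)%N || ((a.1 == b.1) && ~~ a.2 && b.2).
Definition Ind (a b : letter) : bool := lt1 b a || ((a == b) && a.2).

(* Diagram combinatorics (1-indexed: row r from the bottom,            *)
(* column i from the left, column i has height la_i = nth 0 la i.-1).  *)
Definition colh (la : seq nat) (i : nat) : nat := nth 0%N la i.-1.
Definition in_dg (la : seq nat) (r i : nat) : bool :=
  (0 < i <= size la)%N && (0 < r <= colh la i)%N.
Definition leg (la : seq nat) (r i : nat) : nat := (colh la i - r)%N.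

(* A super filling with letters of absolute value in {1..N} is encoded *)
(* as a grid function with value Some (j, b) (the letter of absolute   *)
(* value j+1, negative iff b) on the cells of dg(la) and None outside. *)
Definition gridT (la : seq nat) (N : nat) : finType :=
  {ffun 'I_(head 0%N la) * 'I_(size la) -> option ('I_N * bool)}.

Definition is_filling (la : seq nat) N (F : gridT la N) : bool :=
  [forall c : 'I_(head 0%N la) * 'I_(size la),
     (F c != None) == in_dg la (c.1).+1 (c.2).+1].

Definition entry (la : seq nat) N (F : gridT la N) (r i : nat) : letter :=
  if in_dg la r i then
    match (insub r.-1 : option 'I_(head 0%N la)),
          (insub i.-1 : option 'I_(size la)) with
    | Some a, Some b =>
        match F (a, b) with
        | Some (j, s) => ((nat_of_ord j).+1, s)
        | None => zero_letter
        end
    | _, _ => zero_letter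
    end
  else zero_letter.

Definition maj (la : seq nat) N (F : gridT la N) : nat :=
  \sum_(1 <= i < (size la).+1) \sum_(2 <= r < (colh la i).+1)
    (if Ind (entry F r i) (entry F r.-1 i) then (leg la r i).+1 else 0%N).

(* quinv: number of quinv triples.  For i < j and r with (r,i),(r,j)  *)
(* in dg(la): if (r+1,i) is in dg(la) it is a genuine triple, with    *)
(* a = entry at (r+1,i); otherwise la_i = r and it is degenerate, a=0. *)
Definition quinv_triple (a b c : letter) : bool :=
  (Ind a b + ~~ Ind c b + ~~ Ind a c == 1)%N.

Definition quinv (la : seq nat) N (F : gridT la N) : nat :=
  \sum_(1 <= i < (size la).+1) \sum_(i.+1 <= j < (size la).+1)
  \sum_(1 <= r < (head 0%N la).+1)
    (if in_dg la r i && in_dg la r j then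
       let a := if in_dg la r.+1 i then entry F r.+1 i else zero_letter in
       quinv_triple a (entry F r i) (entry F r j)
     else false).

Definition non_attacking (la : seq nat) N (F : gridT la N) : bool :=
  [forall i : 'I_(size la).+1, forall j : 'I_(size la).+1,
   forall r : 'I_(head 0%N la).+1, forall r' : 'I_(head 0%N la).+1,
     [&& (0 < i)%N, (i < j)%N, in_dg la r i, in_dg la r' j &
         ((nat_of_ord r == r') || (nat_of_ord r == r'.+1))]
     ==> ((entry F r i).1 != (entry F r' j).1)].

Definition mneg (la : seq nat) N (F : gridT la N) : nat :=
  #|[pred c | if F c is Some (_, true) then true else false]|.
Definition ppos (la : seq nat) N (F : gridT la N) : nat :=
  #|[pred c | if F c is Some (_, false) then true else false]|.

Definition all_positive (la : seq nat) N (F : gridT la N) : bool :=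
  [forall c, if F c is Some (_, true) then false else true].

Definition xmon (la : seq nat) N (F : gridT la N) : {mpoly Qqt[N]} :=
  \prod_(c : 'I_(head 0%N la) * 'I_(size la))
     (if F c is Some (j, _) then 'X_j else 1).

Definition Cmac (la : seq nat) (N : nat) : {mpoly Qqt[N]} :=
  \sum_(F : gridT la N | is_filling F && all_positive F)
     (qq ^+ maj F * tt_ ^+ quinv F) *: xmon F.

Definition Csuper (la : seq nat) (N : nat) : {mpoly Qqt[N]} :=
  \sum_(F : gridT la N | is_filling F && non_attacking F)
     ((-1) ^+ mneg F * qq ^+ maj F * tt_ ^+ (ppos F + quinv F)) *: xmon F.

Definition psum (N m : nat) : {mpoly Qqt[N]} := \sum_(i < N) 'X_i ^+ m.
Definition psum_part (N : nat) (mu : seq nat) : {mpoly Qqt[N]} :=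
  \prod_(m <- mu) psum N m.

Definition msym_part (N : nat) (mu : seq nat) : {mpoly Qqt[N]} :=
  \sum_(m : 'X_{1..N < (sumn mu).+1} |
          sort geq [seq x <- [seq (m : 'X_{1..N}) i | i <- enum 'I_N] | (0 < x)%N]
          == mu)
     'X_[(m : 'X_{1..N})].

Definition psum_expansion (N d : nat) (s : seq (Qqt * seq nat))
    (f : {mpoly Qqt[N]}) : Prop :=
  all (fun x => is_partition_of d x.2) s /\
  f = \sum_(x <- s) x.1 *: psum_part N x.2.

(* image of such an expansion under the plethysm f |-> f[X(t-1)] *)
Definition pleth_tm1 (N : nat) (s : seq (Qqt * seq nat)) : {mpoly Qqt[N]} :=
  \sum_(x <- s) (x.1 * \prod_(m <- x.2) (tt_ ^+ m - 1)) *: psum_part N x.2.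

(* Main.v *)
Require Import Defs.
From HB Require Import structures.
From mathcomp Require Import all_boot all_order all_algebra.
From mathcomp Require Import fraction.
From mathcomp Require Import mpoly.
From mathcomp Require Import fingroup perm zify ring.
Set Implicit Arguments. Unset Strict Implicit. Unset Printing Implicit Defensive.
Import GRing.Theory.
Local Open Scope ring_scope.

(** The identity quinv(a, b, c) + I(a, b) = I(c, b) + I(a, c) turns
    q^maj t^quinv into a product over ordered pairs of cells (v, u) of
    beta(v, u)^I(sigma u, sigma v), where beta = t on attacking pairs,
    beta = q^(leg u + 1) / t^arm when v lies just below u, and beta = 1 otherwise.
    In reading order, every pair of cells strictly nested inside a pair with
    beta <> 1 is attacking.

    Symmetry: for two adjacent letters, replacing beta by 1 on an outermost pair
    changes the sum by a multiple of the same sum with both cells removed.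

    Superization: the sum over fillings and the power-sum expression are both
    polynomial of degree at most |lambda| in the alphabet, so alternating sums
    over subsets of more than |lambda| letters vanish, and both are unchanged when
    a positive letter of weight y is deleted together with a negative letter of
    weight -y next above it. These two properties propagate agreement from
    positive alphabets with at most N letters to all signed alphabets.

    In the full super sum, flipping the sign of the first cell that attacks a cell
    of the same absolute value cancels the attacking fillings. In a non-attacking
    filling the entries of a row are distinct in absolute value, which gives the
    dominance bound. *)

(** * Symmetry of weighted subset sums in the weights of two letters *)

Section TwoLetters.
Variables (K : comNzRingType) (T : finType) (key : T -> nat) (t : K).
Hypothesis key_inj : injective key.

(** [key] is a reading order and [t] the weight of attacking pairs. The pair [(v, u)] itself is
    exempt from the conclusion, so it may carry any weight while everything inside it weighs [t]. *)
Definition nested (S : {set T}) (beta : T -> T -> K) : Prop :=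
  forall v u, v \in S -> u \in S -> beta v u != 1 ->
    (key v < key u)%N /\
    forall v' u', v' \in S -> u' \in S -> (v', u') != (v, u) ->
      (key v <= key v')%N -> (key v' < key u')%N -> (key u' <= key u)%N ->
      beta v' u' = t.

Lemma nestedS (S S' : {set T}) beta :
  S' \subset S -> nested S beta -> nested S' beta.
Proof.
move=> /subsetP sS nb v u vS uS buv.
have [lt_vu H] := nb v u (sS _ vS) (sS _ uS) buv.
by split=> // v' u' /sS v'S /sS u'S; apply: H.
Qed.

(** [A] is the set of cells carrying the larger of two letters; the rest of [S] carries the smaller
    one. *)
Definition two_wt (beta : T -> T -> K) (S A : {set T}) : K :=
  \prod_(v in S :\: A) \prod_(u in A) beta v u.

Definition two_sum beta (S : {set T}) (x y : K) : K :=
  \sum_(A : {set T} | A \subset S)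
     two_wt beta S A * (x ^+ #|S :\: A| * y ^+ #|A|).

Lemma two_sum_trivial beta (S : {set T}) x y :
  (forall v u, v \in S -> u \in S -> beta v u = 1) ->
  two_sum beta S x y = two_sum beta S y x.
Proof.
move=> b1.
have sumE a b : two_sum beta S a b =
    \sum_(A : {set T} | A \subset S) a ^+ #|S :\: A| * b ^+ #|A|.
  apply: eq_bigr => A sAS; rewrite /two_wt big1 ?mul1r // => v /setDP[vS _].
  by apply: big1 => u uA; apply: b1 => //; apply: (subsetP sAS).
rewrite !sumE (reindex_onto (fun A => S :\: A) (fun A => S :\: A)) /=.
  apply: eq_big => [A|A /andP[_ /eqP->]]; last by rewrite mulrC.
  rewrite subsetDl /=; apply/eqP/idP => [<-|sAS]; first exact: subsetDl.
  by rewrite setDDr setDv set0U; apply/setIidPr.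
by move=> A sAS; rewrite setDDr setDv set0U; apply/setIidPr.
Qed.

(** The two sums differ only in the sets [A] containing [u] but not [v]. Any other cell [w] then
    contributes [beta v w] if it lies in [A] and [beta w u] otherwise. Both are [t] between [v] and
    [u] by nestedness, and [1] elsewhere by the key order and maximality of the pair. This factor is
    therefore independent of [A] and leaves the sum. *)
Lemma two_sum_remove beta (S : {set T}) v u x y :
  nested S beta -> v \in S -> u \in S -> beta v u != 1 ->
  (forall v' u', v' \in S -> u' \in S -> beta v' u' != 1 ->
     (key u' - key v' <= key u - key v)%N) ->
  two_sum beta S x y =
  two_sum (fun v' u' => if (v', u') == (v, u) then 1 else beta v' u') S x y +
  (beta v u - 1) *
    (\prod_(w in S :\: [set v; u])
       (if (key v < key w < key u)%N then t else 1)) *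
    (x * y) * two_sum beta (S :\: [set v; u]) x y.
Proof.
move=> nb vS uS buv maxuv; set beta' := fun _ _ => _.
have [lt_vu nuv] := nb v u vS uS buv.
have neq_vu : v != u by apply: contraTneq lt_vu => ->; rewrite ltnn.
set S' := S :\: [set v; u]; set tb := \prod_(w in S') _.
have uS' : u \notin S' by rewrite !inE eqxx orbT.
have vS' : v \notin S' by rewrite !inE eqxx.
rewrite /two_sum [RHS]addrC; apply/eqP; rewrite -subr_eq -sumrB; apply/eqP.
under eq_bigr do rewrite -mulrBl.
rewrite (bigID (fun A : {set T} => (v \notin A) && (u \in A))) /=.
rewrite [X in _ + X]big1 ?addr0; last first.
  move=> A /andP[sAS nA]; rewrite [X in X - _](_ : _ = two_wt beta' S A).
    by rewrite subrr mul0r.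
  apply: eq_bigr => v' /setDP[_ v'A]; apply: eq_bigr => u' u'A.
  rewrite /beta'; case: eqP => // -[e1 e2].
  by rewrite -e1 -e2 v'A u'A in nA.
rewrite mulr_sumr.
(* The remaining sets are [u |: A] with [A] a subset of [S']. *)
rewrite (reindex_onto (fun A : {set T} => u |: A) (fun A => A :\ u)) /=; last first.
  by move=> A /andP[_ /andP[_ uA]]; rewrite setD1K.
apply: eq_big => [A|A].
  apply/andP/idP => [[/and3P[/subsetP sAS vA _] /eqP eA]|sAS'].
    apply/subsetP => w wA; rewrite !inE sAS ?inE ?wA ?orbT // andbT negb_or.
    apply/andP; split; first by apply: contra vA => /eqP <-; rewrite !inE wA orbT.
    by move: wA; rewrite -eA !inE => /andP[].
  have nuA : u \notin A by apply: contra uS' => /(subsetP sAS').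
  have nvA : v \notin A by apply: contra vS' => /(subsetP sAS').
  rewrite setU1K // eqxx !inE eqxx (negPf nvA) (negPf neq_vu) /= subUset sub1set uS /=.
  by rewrite (subset_trans sAS') ?subsetDl.
case/andP=> /and3P[/subsetP sAS vA _] /eqP eA.
have nuA : u \notin A by rewrite -eA !inE eqxx.
have nvA : v \notin A by apply: contra vA => vA; rewrite !inE vA orbT.
have sAS' : A \subset S'.
  apply/subsetP => w wA; rewrite !inE sAS ?inE ?wA ?orbT // andbT negb_or.
  by apply/andP; split; apply: contraTneq wA => ->.
have eSA : S :\: (u |: A) = v |: (S' :\: A).
  apply/setP => w; rewrite !inE negb_or; case: (eqVneq w v) => [->|wv] /=.
    by rewrite vS neq_vu nvA.
  by case: (w == u); case: (w \in A).
have vSA : v \notin S' :\: A by rewrite inE negb_and vS' orbT.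
rewrite eSA !cardsU1 vSA nuA /= !add1n !exprS.
have wtE b : two_wt b S (u |: A) =
    b v u * (\prod_(w in A) b v w) * (\prod_(w in S' :\: A) b w u) * two_wt b S' A.
  rewrite /two_wt eSA big_setU1 //= big_setU1 //= -!mulrA; congr (_ * (_ * _)).
  rewrite -big_split /=.
  by apply: eq_bigr => w _; rewrite big_setU1.
have -> : two_wt beta' S (u |: A) =
   (\prod_(w in A) beta v w) * (\prod_(w in S' :\: A) beta w u) * two_wt beta S' A.
  rewrite wtE /beta' eqxx mul1r; congr (_ * _ * _).
  - apply: eq_bigr => w wA; case: eqP => // -[e]; by rewrite -e wA in nuA.
  - apply: eq_bigr => w wA; case: eqP => // -[e]; by rewrite -e wA in vSA.
  - apply: eq_bigr => v' v'A; apply: eq_bigr => u' u'A; case: eqP => // -[e _].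
    by rewrite -e v'A in vSA.
rewrite wtE.
have -> : tb = (\prod_(w in A) beta v w) * (\prod_(w in S' :\: A) beta w u).
  rewrite /tb (big_setID A) /=; congr (_ * _).
    rewrite (setIidPr sAS'); apply: eq_bigr => w wA.
    have wS' := subsetP sAS' _ wA; move: (wS'); rewrite !inE negb_or => /andP[/andP[wv wu] wS].
    case: ifP => [/andP[lt1 lt2]|nlt].
      by rewrite nuv ?leqnn // 1?ltnW // xpair_eqE eqxx (negPf wu).
    case: (eqVneq (beta v w) 1) => // bn1; have [lt1 _] := nb v w vS wS bn1.
    have ne : key w <> key u by move/key_inj/eqP; rewrite (negPf wu).
    by move: nlt ne lt1 lt_vu (maxuv _ _ vS wS bn1); clear; lia.
  apply: eq_bigr => w /setDP[wS' wA].
  move: (wS'); rewrite !inE negb_or => /andP[/andP[wv wu] wS].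
  case: ifP => [/andP[lt1 lt2]|nlt].
    by rewrite nuv ?leqnn // 1?ltnW // xpair_eqE eqxx (negPf wv).
  case: (eqVneq (beta w u) 1) => // bn1; have [lt1 _] := nb w u wS uS bn1.
  have ne : key w <> key v by move/key_inj/eqP; rewrite (negPf wv).
  by move: nlt ne lt1 lt_vu (maxuv _ _ wS uS bn1); clear; lia.
move: (two_wt beta S' A) (\prod_(w in A) beta v w) (\prod_(w in S' :\: A) beta w u) => W P1 P2.
move: (beta v u) (x ^+ _) (y ^+ _) => b X Y.
by ring.
Qed.

(* Changing the weight of an outermost pair to 1 changes the sum by a multiple
   of the sum with that pair deleted, so one inducts on cells and pairs. *)
Lemma two_sumC beta (S : {set T}) x y :
  nested S beta -> two_sum beta S x y = two_sum beta S y x.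
Proof.
(* The measure drops both when a weight is reset to 1 and when two cells are deleted. *)
have [n] := ubnP (#|S| + #|[set p in setX S S | beta p.1 p.2 != 1%R]|).
elim: n S beta => // n IHn S beta; rewrite ltnS => le_n nb.
pose E := [set p in setX S S | beta p.1 p.2 != 1].
case: (set_0Vmem E) => [E0|[p0 p0E]].
  apply: two_sum_trivial => v u vS uS; apply/eqP; apply: contraT => buv.
  have : (v, u) \in E by rewrite /E !inE vS uS buv.
  by rewrite E0 in_set0.
(* A pair of non-trivial weight at the greatest key distance is nested in no other such pair. *)
case: (arg_maxnP (fun p : T * T => key p.2 - key p.1)%N p0E) => -[v u] /= vuE maxuv.
have := vuE : (v, u) \in E; rewrite /E !inE /= => /andP[/andP[vS uS] buv].
have maxuv' v' u' : v' \in S -> u' \in S -> beta v' u' != 1 ->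
     (key u' - key v' <= key u - key v)%N.
  by move=> v'S u'S b'; apply: (maxuv (v', u')); change ((v', u') \in E); rewrite /E !inE v'S u'S b'.
rewrite !(two_sum_remove _ _ nb vS uS buv maxuv'); congr (_ + _).
  apply: IHn.
    apply: leq_trans le_n; rewrite ltn_add2l proper_card //; apply/properP; split.
      apply/subsetP => -[a b]; rewrite !inE /=; case: ifP => _ //.
      by rewrite eqxx andbF.
    by exists (v, u) => //; rewrite !inE /= !eqxx andbF.
  move=> a b aS bS; case: ifPn; rewrite ?eqxx // => nab bab.
  have [lt_ab nab'] := nb a b aS bS bab; split=> // a' b' a'S b'S ne le1 lt2 le3.
  case: ifPn => [/eqP[ea eb]|_]; last exact: nab'.
  (* Were the reset pair inside [(a, b)], the latter would have a greater key distance. *)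
  have mx := maxuv' _ _ aS bS bab; subst a' b'.
  have ne' : key a <> key v \/ key b <> key u.
    case: (eqVneq a v) => [av|av]; last by left=> /key_inj/eqP; rewrite (negPf av).
    case: (eqVneq b u) => [bu|bu]; last by right=> /key_inj/eqP; rewrite (negPf bu).
    by rewrite av bu eqxx in nab.
  by move: mx ne' le1 lt2 le3; clear; lia.
congr (_ * _); first by rewrite (mulrC x).
have sS : S :\: [set v; u] \subset S by apply: subsetDl.
apply: IHn; last exact: nestedS nb.
apply: leq_trans le_n; rewrite -addSn leq_add //.
  by rewrite proper_card //; apply/properP; split=> //; exists v; rewrite ?inE ?eqxx.
apply/subset_leq_card/subsetP => -[a b]; rewrite !inE /=.
by case/andP=> /andP[/andP[_ ->] /andP[_ ->]] ->.
Qed.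

End TwoLetters.

(** * Sums over fillings and their invariance under permutations of the letters *)

Section FillingSum.
Variables (K : comNzRingType) (T : finType) (beta : T -> T -> K).

Definition fill_wt (L : finType) (I : rel L) (s : {ffun T -> L}) : K :=
  \prod_v \prod_u (if I (s u) (s v) then beta v u else 1).

Definition fill_sum (L : finType) (I : rel L) (w : L -> K) : K :=
  \sum_(s : {ffun T -> L}) fill_wt I s * \prod_u w (s u).

Section Swap.
Variables (L : finType) (I : rel L) (i j : L).
Hypotheses (Iii : ~~ I i i) (Ijj : ~~ I j j) (Iij : ~~ I i j) (Iji : I j i).
Hypothesis Ir : forall z, z != i -> z != j -> I z i = I z j.
Hypothesis Il : forall z, z != i -> z != j -> I i z = I j z.

(** A fibre of this map fixes the set of cells carrying [i] or [j], and all other entries. *)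
Definition collapse (s : {ffun T -> L}) : {ffun T -> L} :=
  [ffun u => if s u == j then i else s u].

(** Inside a fibre only the set of cells carrying [j] varies. Other letters compare alike with [i]
    and [j], so only pairs of cells that both carry [i] or [j] change their factor, and these form a
    [two_sum]. *)
Lemma fill_sum_fiber (w : L -> K) (r : {ffun T -> L}) :
  (forall u, r u != j) ->
  \sum_(s : {ffun T -> L} | collapse s == r) fill_wt I s * \prod_u w (s u) =
  (\prod_v \prod_u (if (r u == i) && (r v == i) then 1
                    else if I (r u) (r v) then beta v u else 1)) *
  (\prod_(u | r u != i) w (r u)) *
  two_sum beta [set u | r u == i] (w i) (w j).
Proof.
move=> rj; set S := [set u | r u == i].
have neq_ij : i != j by apply: contraTneq Iji => <-.
pose h (A : {set T}) : {ffun T -> L} := [ffun u => if u \in A then j else r u].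
rewrite (reindex_onto h (fun s => [set u | s u == j])) /=; last first.
  move=> s /eqP rE; apply/ffunP => u; rewrite ffunE inE -rE ffunE.
  by case: eqP => // ->.
rewrite /two_sum mulr_sumr; apply: eq_big => [A|A].
  apply/andP/subsetP => [[/eqP rE _] u uA|sAS].
    by rewrite inE -rE !ffunE uA eqxx.
  split; apply/eqP.
    apply/ffunP => u; rewrite !ffunE; case: (boolP (u \in A)) => uA; last by rewrite (negPf (rj u)).
    by rewrite eqxx; apply/esym/eqP; have := sAS u uA; rewrite inE.
  by apply/setP => u; rewrite !inE ffunE; case: ifP => _; rewrite ?eqxx // (negPf (rj u)).
case/andP=> /eqP rE _.
have AS u : u \in A -> r u = i by move=> uA; rewrite -rE !ffunE uA eqxx.
have sAS : A \subset S by apply/subsetP => u /AS; rewrite inE => ->.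
have -> : fill_wt I (h A) =
    \prod_v \prod_u (if (r u == i) && (r v == i) then 1
                    else if I (r u) (r v) then beta v u else 1) * two_wt beta S A.
  rewrite /two_wt [X in _ = _ * X]big_mkcond -big_split /=; apply: eq_bigr => v _.
  have -> : (if v \in S :\: A then \prod_(u in A) beta v u else 1) =
      \prod_u (if (v \in S :\: A) && (u \in A) then beta v u else 1).
    by case: ifP => _; rewrite /= ?[in LHS]big_mkcond //= big1.
  rewrite -big_split; apply: eq_bigr => u _ /=; rewrite !inE !ffunE.
  have [uA|uA] := boolP (u \in A); have [vA|vA] := boolP (v \in A) => /=.
  - by rewrite (negPf Ijj) (AS u uA) (AS v vA) eqxx mulr1.
  - rewrite (AS u uA) eqxx /=; case: (eqVneq (r v) i) => [->|rv] /=.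
      by rewrite Iji mul1r.
    by rewrite mulr1 Il.
  - rewrite (AS v vA) eqxx andbT; case: (eqVneq (r u) i) => [->|ru].
      by rewrite (negPf Iij) mulr1.
    by rewrite mulr1 Ir.
  - rewrite andbF mulr1; case: (eqVneq (r u) i) => [->|ru] //=.
    by case: (eqVneq (r v) i) => [->|rv] //=; rewrite (negPf Iii).
have -> : \prod_u w (h A u) =
    \prod_(u | r u != i) w (r u) * (w i ^+ #|S :\: A| * w j ^+ #|A|).
  rewrite (bigID (fun u => r u == i)) /= mulrC; congr (_ * _).
    apply: eq_bigr => u ru; rewrite ffunE; case: ifP => // /AS e.
    by rewrite e eqxx in ru.
  rewrite (bigID (fun u => u \in A)) /= mulrC; congr (_ * _).
    rewrite -prodr_const; apply: eq_big => [u|u /andP[/eqP e uA]].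
      by rewrite !inE andbC.
    by rewrite ffunE (negPf uA) e.
  rewrite -prodr_const; apply: eq_big => [u|u /andP[_ uA]].
    by apply: andb_idl => /AS ->.
  by rewrite ffunE uA.
rewrite -!mulrA; congr (_ * _); rewrite mulrCA; congr (_ * _).
Qed.

Lemma fill_sum_swap (w : L -> K) (key : T -> nat) (t : K) :
  injective key -> nested key t [set: T] beta ->
  fill_sum I (fun x => w (tperm i j x)) = fill_sum I w.
Proof.
move=> kI nb; rewrite /fill_sum.
rewrite [LHS](partition_big collapse predT) // [RHS](partition_big collapse predT) //=.
apply: eq_bigr => r _.
(* A filling that still uses [j] is not collapsed, so its fibre is empty. *)
case: (pickP (fun u => r u == j)) => [u /eqP ru|rj].
  have neq_ij : i != j by apply: contraTneq Iji => <-.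
  rewrite !big_pred0 // => s; apply/eqP => rE; move: ru; rewrite -rE ffunE;
  by case: eqP => [_ /eqP|//]; rewrite ?(negPf neq_ij).
have rj' u : r u != j by rewrite rj.
rewrite (fill_sum_fiber (fun x => w (tperm i j x)) rj') (fill_sum_fiber w rj').
rewrite tpermL tpermR; congr (_ * _ * _).
  by apply: eq_bigr => u ru; rewrite tpermD // eq_sym.
by apply: (two_sumC kI); apply: nestedS nb; apply: subsetT.
Qed.

End Swap.

Definition ord_gt N : rel 'I_N := fun a b => (b < a)%N.

(** The permutations preserving the sum are closed under composition. They include the adjacent
    transpositions, hence all transpositions by conjugation, hence everything. *)
Lemma fill_sum_perm N (w : 'I_N -> K) (key : T -> nat) (t : K) (s : 'S_N) :
  injective key -> nested key t [set: T] beta ->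
  fill_sum (@ord_gt N) (fun x => w (s x)) =
  fill_sum (@ord_gt N) w.
Proof.
move=> kI nb; pose G (w : 'I_N -> K) := fill_sum (@ord_gt N) w.
rewrite -/(G (fun x => w (s x))) -/(G w).
have Gext f g : f =1 g -> G f = G g.
  move=> fg; apply: eq_bigr => f' _; congr (_ * _); apply: eq_bigr => u _; exact: fg.
pose inv (p : 'S_N) := forall w : 'I_N -> K, G (fun x => w (p x)) = G w.
suff: inv s by apply.
have invM p p' : inv p -> inv p' -> inv (p * p')%g.
  move=> ip ip' f; rewrite -[RHS]ip' -[RHS]ip; apply: Gext => x; by rewrite permM.
have adj (a b : 'I_N) : b = a.+1 :> nat -> inv (tperm a b).
  move=> ab f; apply: (fill_sum_swap _ _ _ _ _ _ f kI nb); rewrite /ord_gt ?ltnn // ab ?ltnSn //.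
  - by rewrite -leqNgt leqW.
  - move=> z /eqP za /eqP zb; apply/idP/idP; rewrite ?ab.
      have : z <> b :> nat by move/val_inj. by rewrite ab; lia.
    by lia.
  - move=> z /eqP za /eqP zb; apply/idP/idP; rewrite ?ab; first by lia.
    have : z <> a :> nat by move/val_inj. by lia.
have trans m (a b : 'I_N) : b = (a + m.+1)%N :> nat -> inv (tperm a b).
  elim: m b => [|m IHm] b ab; first by apply: adj; rewrite ab addn1.
  have cN : (a + m.+1 < N)%N by rewrite (leq_ltn_trans _ (ltn_ord b)) // ab; lia.
  (* [c] is the letter just before [b]; conjugating the transposition of [a] and [c] by the adjacent
     one of [c] and [b] gives that of [a] and [b]. *)
  pose c := Ordinal cN.
  have ic : inv (tperm c b) by apply: adj; rewrite /= ab; lia.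
  have ia : inv (tperm a c) by apply: IHm.
  have i3 := invM _ _ (invM _ _ ic ia) ic.
  suff e : (tperm c b * tperm a c * tperm c b)%g = tperm a b by rewrite e in i3.
  have ac : a != c by apply/eqP => /(congr1 val) /=; lia.
  have ab' : a != b by apply/eqP => /(congr1 val) /=; lia.
  have := tpermJ a c (tperm c b); rewrite tpermL tpermD 1?eq_sym // => <-.
  by rewrite conjgE tpermV mulgA.
case: (prod_tpermP s) => ts -> _.
elim: ts => [|[a b] ts IH]; first by rewrite big_nil => f; apply: Gext => x; rewrite perm1.
rewrite big_cons; apply: invM => //=.
case: (ltngtP a b) => [lt|gt|/val_inj ->]; last by rewrite tperm1 => f; apply: Gext => x; rewrite perm1.
  by apply: (trans (b - a).-1); lia.
by rewrite tpermC; apply: (trans (a - b).-1); lia.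
Qed.

End FillingSum.

(** * Inclusion-exclusion and cancellation for signed alphabets *)

Section Superization.
Variables (K : comNzRingType) (T : finType) (beta : T -> T -> K).
Hypothesis char_neq2 : forall x : K, x = - x -> x = 0.

(** Switching letters off by a zero weight keeps the alphabet type fixed while its support
    varies. *)
Definition zero_on (L : finType) (w : L -> K) (X : {set L}) (x : L) : K :=
  if x \in X then 0 else w x.

Lemma eq_fill_sum (L : finType) (I : rel L) (w w' : L -> K) :
  w =1 w' -> fill_sum beta I w = fill_sum beta I w'.
Proof.
by move=> e; apply: eq_bigr => s _; congr (_ * _); apply: eq_bigr => u _; apply: e.
Qed.

(** A map from [J] misses some letter [b] of [B], and toggling [b] in [S] changes only the sign. [J]
    will be the set of cells for filling sums and the set of factors for products of power sums. *)
Lemma incl_excl (L J : finType) (c : {ffun J -> L} -> K) (g : J -> L -> K -> K)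
    (w : L -> K) (B : {set L}) :
  (#|J| < #|B|)%N ->
  \sum_(S : {set L} | S \subset B) (-1) ^+ #|S| *
     \sum_(f : {ffun J -> L}) c f * \prod_i g i (f i) (zero_on w (B :\: S) (f i)) = 0.
Proof.
move=> ltJB; under eq_bigr do rewrite mulr_sumr.
rewrite exchange_big /=; apply: big1 => f _.
have [b bB bf] : exists2 b, b \in B & b \notin codom f.
  apply/exists_inP; apply: contraTT ltJB; rewrite negb_exists_in -leqNgt => /forall_inP H.
  rewrite -(size_codom f) (leq_trans _ (card_size _)) // subset_leq_card //.
  by apply/subsetP => b /H; rewrite negbK.
pose tg (S : {set L}) := if b \in S then S :\ b else b |: S.
have tgK : involutive tg.
  move=> S; rewrite /tg; case: (boolP (b \in S)) => bS; rewrite !inE eqxx //= ?setD1K //.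
  by rewrite setU1K.
apply: char_neq2; rewrite [LHS](reindex_inj (inv_inj tgK)) /= -sumrN.
apply: eq_big => [S|S _].
  rewrite /tg; case: ifP => bS; last by rewrite subUset sub1set bB.
  by rewrite -{2}(setD1K bS) subUset sub1set bB.
have -> : \prod_i g i (f i) (zero_on w (B :\: tg S) (f i)) =
          \prod_i g i (f i) (zero_on w (B :\: S) (f i)).
  apply: eq_bigr => i _; rewrite /zero_on !inE.
  have fb : f i != b by apply: contraNneq bf => <-; apply: codom_f.
  by rewrite /tg; case: (b \in S); rewrite !inE (negPf fb).
rewrite -mulNr; congr (_ * _); rewrite /tg; case: ifP => bS.
  by rewrite (cardsD1 b S) bS /= exprS mulN1r opprK.
by rewrite cardsU1 bS /= exprS mulN1r.
Qed.

(** In a filling using [a] or [b], exchange the two letters at the first such cell. Earlier cells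
    carry other letters, which compare alike with both. For later cells [I x a] and [I x b] agree,
    also when [x] is [a] or [b]. The pair weights are unchanged and the monomial changes sign. *)
Lemma fill_sum_cancel (L : finType) (I : rel L) (w : L -> K) (a b : L)
    (key : T -> nat) :
  injective key -> (forall v u, beta v u != 1 -> (key v < key u)%N) ->
  ~~ I a a -> ~~ I a b -> I b a -> I b b -> w a = - w b ->
  (forall z, z != a -> z != b -> w z != 0 -> I z a = I z b /\ I a z = I b z) ->
  fill_sum beta I w = fill_sum beta I (zero_on w [set a; b]).
Proof.
move=> kI bk Iaa Iab Iba Ibb wab Iz.
have neq_ab : a != b by apply: contraNneq Iab => {1}->.
pose ab : {set L} := [set a; b].
pose P (s : {ffun T -> L}) := [exists u, s u \in ab].
rewrite /fill_sum (bigID P) /= [X in X + _](_ : _ = 0) ?add0r; last first.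
  pose fst (s : {ffun T -> L}) u :=
    (s u \in ab) && [forall v, (s v \in ab) ==> (key u <= key v)%N].
  pose tg (s : {ffun T -> L}) : {ffun T -> L} :=
    [ffun u => if fst s u then tperm a b (s u) else s u].
  have abE x : (tperm a b x \in ab) = (x \in ab).
    by rewrite !inE; case: tpermP => [->|->|]; rewrite ?eqxx ?orbT.
  have tgab s u : (tg s u \in ab) = (s u \in ab).
    by rewrite ffunE; case: ifP.
  have fstE s u : fst (tg s) u = fst s u.
    rewrite /fst tgab; congr (_ && _); apply: eq_forallb => v; by rewrite tgab.
  have tgK : involutive tg.
    move=> s; apply/ffunP => u; rewrite ffunE fstE ffunE.
    by case: (fst s u); rewrite ?tpermK.
  have PE s : P (tg s) = P s by apply: eq_existsb => u; rewrite tgab.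
  apply: char_neq2; rewrite [LHS](reindex_inj (inv_inj tgK)) /= -sumrN.
  apply: eq_big => [s|s]; first by rewrite PE.
  rewrite PE => /existsP[u1 u1ab].
  case: (@arg_minnP T u1 (fun u => s u \in ab) key u1ab) => u0 u0ab u0min.
  have fu0 : fst s u0.
    by rewrite /fst u0ab; apply/forallP => v; apply/implyP; apply: u0min.
  have fstu u : fst s u = (u == u0).
    apply/idP/eqP => [/andP[uab /forallP/(_ u0)]|->//].
    by rewrite u0ab /= => le; apply: kI; apply/eqP; rewrite eqn_leq le u0min.
  have tgE u : tg s u = if u == u0 then tperm a b (s u) else s u.
    by rewrite ffunE fstu.
  (* The comparison hypothesis covers only letters of non-zero weight; a filling using any other
     letter besides [a] and [b] contributes zero anyway. *)
  have [/existsP[z /andP[zab wz]]|nz] := boolP [exists z, (s z \notin ab) && (w (s z) == 0)].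
    have zu0 : z != u0 by apply: contraNneq zab => ->.
    rewrite (bigD1 z) //= tgE (negPf zu0) (eqP wz) mul0r mulr0.
    by rewrite (bigD1 z) //= (eqP wz) mul0r mulr0 oppr0.
  have nz' u : s u \notin ab -> w (s u) != 0.
    by move=> sab; apply: contra nz => wz; apply/existsP; exists u; rewrite sab.
  have -> : fill_wt beta I (tg s) = fill_wt beta I s.
    apply: eq_bigr => v _; apply: eq_bigr => u _.
    case: (eqVneq (beta v u) 1) => [->|/bk kvu]; first by rewrite !if_same.
    rewrite !tgE; case: (eqVneq u u0) => [uu0|uu0].
      have vab : s v \notin ab by apply: contraTN kvu => /u0min; rewrite -leqNgt uu0.
      have vu0 : v != u0 by apply: contraNneq vab => ->.
      have [za zb] : s v != a /\ s v != b by move: vab; rewrite !inE negb_or => /andP[].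
      rewrite (negPf vu0) uu0; have [_ e] := Iz _ za zb (nz' _ vab).
      by case: tpermP => [->|->|//]; rewrite e.
    case: (eqVneq v u0) => [vu0|//].
    have e : I (s u) a = I (s u) b.
      have [|uab] := boolP (s u \in ab).
        by rewrite !inE => /orP[]/eqP->; rewrite ?(negPf Iaa) ?(negPf Iab) ?Iba ?Ibb.
      have [za zb] : s u != a /\ s u != b by move: uab; rewrite !inE negb_or => /andP[].
      by have [] := Iz _ za zb (nz' _ uab).
    by case: tpermP => [->|->|//]; rewrite e.
  rewrite -mulrN; congr (_ * _); rewrite (bigD1 u0) //= [in RHS](bigD1 u0) //= -mulNr.
  congr (_ * _); last first.
    by apply: eq_bigr => u uu0; rewrite tgE (negPf uu0).
  rewrite tgE eqxx; move: u0ab; rewrite !inE => /orP[]/eqP->.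
    by rewrite tpermL wab opprK.
  by rewrite tpermR wab.
rewrite [RHS](bigID P) /= [X in _ = X + _]big1 ?add0r.
  apply: eq_bigr => s nP; congr (_ * _); apply: eq_bigr => u _.
  by rewrite /zero_on ifN //; apply: contra nP => sab; apply/existsP; exists u.
move=> s /existsP[u sab]; rewrite (bigD1 u) //= {1}/zero_on ifT //.
by rewrite mul0r mulr0.
Qed.

Lemma fill_sum_embed (L1 L2 : finType) (I1 : rel L1) (I2 : rel L2) (e : L1 -> L2)
    (w : L2 -> K) :
  injective e -> (forall x y, I2 (e x) (e y) = I1 x y) ->
  (forall z, z \notin codom e -> w z = 0) ->
  fill_sum beta I2 w = fill_sum beta I1 (fun x => w (e x)).
Proof.
move=> eI eE w0; pose h (s : {ffun T -> L1}) : {ffun T -> L2} := [ffun u => e (s u)].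
have hI : injective h.
  by move=> s s' /ffunP E; apply/ffunP => u; have := E u; rewrite !ffunE => /eI.
rewrite /fill_sum (bigID (fun s => s \in h @: [set: {ffun T -> L1}])) /=.
rewrite [X in _ + X]big1 ?addr0; last first.
  move=> s sh; have /existsP[u su] : [exists u, s u \notin codom e].
    apply: contraR sh; rewrite negb_exists => /forallP H.
    have H' u : s u \in codom e by have := H u; rewrite negbK.
    apply/imsetP; exists [ffun u => iinv (H' u)]; first by rewrite inE.
    by apply/ffunP => u; rewrite !ffunE f_iinv.
  by rewrite (bigD1 u) //= w0 // mul0r mulr0.
rewrite big_imset /=; last by move=> s s' _ _; apply: hI.
rewrite [LHS]big_mkcond /=.
apply: eq_bigr => s _; rewrite inE; congr (_ * _).
  by apply: eq_bigr => v _; apply: eq_bigr => u _; rewrite !ffunE eE.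
by apply: eq_bigr => u _; rewrite ffunE.
Qed.

(** Superized power sum: a negative letter contributes [- (- w x) ^+ m], which cancels a positive
    letter of the opposite weight. *)
Definition super_psum (L : finType) (neg : pred L) (w : L -> K) (m : nat) : K :=
  \sum_x (if neg x then - (- w x) ^+ m else w x ^+ m).

Definition super_pexp (s : seq (K * seq nat)) (L : finType) (neg : pred L)
    (w : L -> K) : K :=
  \sum_(x <- s) x.1 * \prod_(m <- x.2) super_psum neg w m.

Lemma eq_super_pexp s (L : finType) (neg : pred L) (w w' : L -> K) :
  w =1 w' -> super_pexp s neg w = super_pexp s neg w'.
Proof.
move=> e; apply: eq_bigr => x _; congr (_ * _); apply: eq_bigr => m _.
by apply: eq_bigr => y _; rewrite e.
Qed.

(** A product of at most [d] power sums expands into a sum over maps from its factors to the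
    letters, to which [incl_excl] applies. *)
Lemma super_pexp_incl_excl s (L : finType) (neg : pred L) (w : L -> K)
    (B : {set L}) d :
  all (fun x => size x.2 <= d)%N s -> (d < #|B|)%N ->
  \sum_(S : {set L} | S \subset B) (-1) ^+ #|S| *
     super_pexp s neg (zero_on w (B :\: S)) = 0.
Proof.
move=> /allP sd ltdB; under eq_bigr do rewrite mulr_sumr.
rewrite exchange_big /=; rewrite big_seq; apply: big1 => x /sd szx.
under eq_bigr do rewrite mulrCA; rewrite -mulr_sumr.
pose g (i : 'I_(size x.2)) (y : L) (z : K) :=
  if neg y then - (- z) ^+ (nth 0%N x.2 i) else z ^+ (nth 0%N x.2 i).
rewrite (_ : \sum_(S | _) _ = 0) ?mulr0 //.
have := @incl_excl L 'I_(size x.2) (fun=> 1) g w B.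
rewrite card_ord => /(_ (leq_ltn_trans szx ltdB)) H; rewrite -[RHS]H.
apply: eq_bigr => S _; congr (_ * _).
rewrite (big_nth 0%N) big_mkord bigA_distr_bigA /=.
by apply: eq_bigr => f _; rewrite mul1r.
Qed.

Lemma super_pexp_cancel s (L : finType) (neg : pred L) (w : L -> K) a b :
  ~~ neg a -> neg b -> w a = - w b ->
  super_pexp s neg w = super_pexp s neg (zero_on w [set a; b]).
Proof.
move=> na nb wab; have neq_ba : b != a by apply: contraNneq na => <-.
apply: eq_bigr => x _; congr (_ * _); apply: eq_bigr => m _.
rewrite /super_psum [LHS](bigD1 a) //= [RHS](bigD1 a) //=.
rewrite [X in _ + X](bigD1 b) //= [in RHS](bigD1 b) //= !addrA (negPf na) nb.
rewrite /zero_on !inE !eqxx orbT /= oppr0 wab subrr addrN !add0r.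
by apply: eq_bigr => y /andP[/negPf ya /negPf yb]; rewrite !inE ya yb.
Qed.

(** Positive parts are what makes letters of weight zero contribute nothing, a zeroth power being
    1. *)
Lemma super_pexp_embed s (L1 L2 : finType) (neg1 : pred L1) (neg2 : pred L2)
    (e : L1 -> L2) (w : L2 -> K) :
  all (fun x => all (fun m => 0 < m)%N x.2) s ->
  injective e -> (forall x, neg2 (e x) = neg1 x) ->
  (forall z, z \notin codom e -> w z = 0) ->
  super_pexp s neg2 w = super_pexp s neg1 (fun x => w (e x)).
Proof.
move=> /allP pos eI eE w0; rewrite /super_pexp big_seq [RHS]big_seq.
apply: eq_bigr => x /pos/allP xpos; congr (_ * _).
rewrite big_seq [RHS]big_seq; apply: eq_bigr => m /xpos m0.
rewrite /super_psum (bigID (fun z => z \in e @: [set: L1])) /= [X in _ + X]big1 ?addr0.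
  rewrite big_imset /=; last by move=> z z' _ _; apply: eI.
  by rewrite [LHS]big_mkcond; apply: eq_bigr => z _; rewrite inE eE.
move=> z ze; rewrite w0 ?oppr0 ?expr0n ?(gtn_eqF m0) ?oppr0 ?if_same //.
by apply: contra ze => /codomP[y ->]; apply: imset_f.
Qed.

(** For injective [lk] this is the comparison I of a linear order: a letter is related to itself
    exactly when it is negative. *)
Definition super_rel (L : finType) (lk : L -> nat) (neg : pred L) : rel L :=
  fun x y => (lk y < lk x)%N || ((lk x == lk y) && neg x).

(** * Agreement with the power-sum expression, from positive to signed alphabets *)

Section Main.
Variables (s : seq (K * seq nat)) (N : nat) (key : T -> nat).
Local Notation d := #|T|.
Hypothesis key_inj : injective key.
Hypothesis beta_key : forall v u, beta v u != 1 -> (key v < key u)%N.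
Hypothesis leTN : (d <= N)%N.
Hypothesis s_pos : all (fun x => all (fun m => 0 < m)%N x.2) s.
Hypothesis s_size : all (fun x => size x.2 <= d)%N s.
Hypothesis base : forall w : 'I_N -> K,
  fill_sum beta (@ord_gt N) w = super_pexp s xpred0 w.

Lemma incl_excl_diff (L : finType) (I : rel L) (neg : pred L) w (B : {set L}) :
  (d < #|B|)%N ->
  \sum_(S : {set L} | S \subset B) (-1) ^+ #|S| *
    (fill_sum beta I (zero_on w (B :\: S)) -
     super_pexp s neg (zero_on w (B :\: S))) = 0.
Proof.
move=> ltB; under eq_bigr do rewrite mulrBr.
rewrite sumrB (super_pexp_incl_excl _ _ s_size) // subr0.
exact: (@incl_excl _ T (fill_wt beta I) (fun _ _ z => z)).
Qed.

Section Alphabet.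
Variables (L : finType) (lk : L -> nat) (neg : pred L).
Hypothesis lk_inj : injective lk.
Local Notation I := (super_rel lk neg).

(** The letters of non-zero weight, at most [N] and all positive, are listed in increasing order as
    an initial segment of ['I_N]; padding with zero weights reduces the claim to [base]. *)
Lemma superize_small (w : L -> K) :
  (forall x, neg x -> w x = 0) -> (#|[set x | w x != 0%R]| <= N)%N ->
  fill_sum beta I w = super_pexp s neg w.
Proof.
move=> wneg leN; set S := [set x | w x != 0] in leN.
pose r := sort (fun x y => lk x <= lk y)%N (enum S).
have szr : size r = #|S| by rewrite size_sort cardE.
have ur : uniq r by rewrite sort_uniq enum_uniq.
have mr x : (x \in r) = (w x != 0) by rewrite mem_sort mem_enum inE.
have srt : sorted ltn (map lk r).
  rewrite ltn_sorted_uniq_leq map_inj_uniq // ur /= sorted_map.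
  by apply: sort_sorted => x y; apply: leq_total.
pose e1 (k : 'I_(size r)) := tnth (in_tuple r) k.
have leN' : (size r <= N)%N by rewrite szr.
pose e2 (k : 'I_(size r)) : 'I_N := widen_ord leN' k.
have e1homo (k k' : 'I_(size r)) : (k < k')%N -> (lk (e1 k) < lk (e1 k'))%N.
  move=> ltk; rewrite /e1 !(tnth_nth (e1 k)) /= -!(nth_map (e1 k) 0%N) ?ltn_ord //.
  by apply: (sorted_ltn_nth ltn_trans); rewrite ?inE ?size_map ?ltn_ord.
have e1lt (k k' : 'I_(size r)) : (lk (e1 k) < lk (e1 k'))%N = (k < k')%N.
  apply/idP/idP; last exact: e1homo.
  case: (ltngtP k k') => [//|/e1homo lt|/val_inj ->]; last by rewrite ltnn.
  by rewrite ltnNge ltnW.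
have e1I : injective e1.
  by move=> k k' /eqP; rewrite /e1 !(tnth_nth (e1 k)) /= nth_uniq // => /eqP/val_inj.
have e1S z : z \notin codom e1 -> w z = 0.
  move=> ze; apply/eqP; apply: contraNT ze; rewrite -mr => zr.
  have iz : (index z r < size r)%N by rewrite index_mem.
  by apply/codomP; exists (Ordinal iz); rewrite /e1 (tnth_nth z) /= nth_index.
have e1n k : neg (e1 k) = false.
  apply/negP => /wneg/eqP; apply/negP; rewrite -mr; exact: mem_tnth.
rewrite (fill_sum_embed (I1 := @ord_gt _) e1I) //; last first.
  by move=> x y; rewrite /super_rel e1n andbF orbF e1lt.
rewrite (super_pexp_embed (neg1 := xpred0) s_pos e1I) //.
pose w' (j : 'I_N) := if insub (val j) is Some k then w (e1 k) else 0.
have e2I : injective e2 by move=> k k' /(congr1 val) /= /val_inj.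
have w'E k : w' (e2 k) = w (e1 k).
  rewrite /w' /=; case: insubP => [k' _ /val_inj -> //|]; by rewrite ltn_ord.
have e2S z : z \notin codom e2 -> w' z = 0.
  move=> ze; rewrite /w'; case: insubP => // k _ kz; case/negP: ze.
  by apply/codomP; exists k; apply: val_inj.
rewrite -(eq_fill_sum _ w'E) -(eq_super_pexp _ _ w'E).
rewrite -(fill_sum_embed (I2 := @ord_gt N) e2I) //.
by rewrite -(super_pexp_embed (neg2 := xpred0) s_pos e2I).
Qed.

(** Induction on the support [B]. If it has more than [N] letters, hence more than [d], the
    alternating sum of the differences over its subsets vanishes. Proper subsets contribute zero by
    induction, so [B] does too. *)
Lemma superize_pos (w : L -> K) :
  (forall x, neg x -> w x = 0) -> fill_sum beta I w = super_pexp s neg w.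
Proof.
have [n] := ubnP (#|[set x | w x != 0%R]|).
elim: n w => // n IHn w; rewrite ltnS; set B := [set x | _] => leB wneg.
have [leN|ltN] := leqP #|B| N; first exact: superize_small.
have := incl_excl_diff I neg w (leq_ltn_trans leTN ltN).
rewrite (bigD1 B) //= big1 ?addr0.
  have wB : zero_on w (B :\: B) =1 w by move=> x; rewrite /zero_on setDv inE.
  rewrite (eq_fill_sum _ wB) (eq_super_pexp _ _ wB) => /eqP.
  by rewrite -signr_odd mulr_sign; case: odd; rewrite ?oppr_eq0 subr_eq0 => /eqP.
move=> S /andP[sSB neqSB]; rewrite IHn ?subrr ?mulr0 //.
  apply: leq_trans leB; apply: proper_card; rewrite properE.
  have sub : [set x | zero_on w (B :\: S) x != 0] \subset S.
    apply/subsetP => x; rewrite inE /zero_on; case: ifP; rewrite ?eqxx // !inE.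
    by case: (x \in S) => //= ->.
  rewrite (subset_trans sub sSB) /=; apply: contra neqSB => sB.
  by rewrite eqEsubset sSB (subset_trans sB sub).
by move=> x nx; rewrite /zero_on; case: ifP => // _; apply: wneg.
Qed.

End Alphabet.

(* Block j of the alphabet holds a positive letter, then d + 1 spare positive
   letters, then a negative letter. *)
Definition blk_key M (x : 'I_M * 'I_d.+3) : nat := (x.1 * d.+3 + x.2)%N.
Definition blk_neg M (x : 'I_M * 'I_d.+3) : bool := x.2 == ord_max.
Definition blk_spare M (j : 'I_M) : {set 'I_M * 'I_d.+3} :=
  [set x : 'I_M * 'I_d.+3 | (x.1 == j) && (0 < x.2 < d.+2)%N].

Lemma blk_key_inj M : injective (@blk_key M).
Proof.
move=> [j i] [j' i']; rewrite /blk_key /= => E.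
have e : i = i' :> nat.
  by have := congr1 (modn^~ d.+3) E; rewrite /= !modnMDl !modn_small.
have e' : j = j' :> nat.
  by have := congr1 (divn^~ d.+3) E; rewrite /= !divnMDl // !divn_small // !addn0.
by rewrite (val_inj e) (val_inj e').
Qed.

(** Induction on the number of blocks whose negative letter has non-zero weight. Let [b] be such a
    letter, give every spare letter of its block the opposite weight, and apply inclusion-exclusion
    over them. The empty set yields the claim for [w]. For a non-empty set the largest spare letter
    kept cancels against [b], leaving fewer active negative letters. *)
Lemma superize_blocks M (w : 'I_M * 'I_d.+3 -> K) :
  (forall j, w (j, ord_max) != 0 -> forall x, x \in blk_spare j -> w x = 0) ->
  fill_sum beta (super_rel (@blk_key M) (@blk_neg M)) w = super_pexp s (@blk_neg M) w.
Proof.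
have [n] := ubnP (#|[set j | w (j, ord_max) != 0%R]|).
elim: n w => // n IHn w; rewrite ltnS => leB wsp.
case: (set_0Vmem [set j | w (j, ord_max) != 0]) => [E0|[j jE]].
  apply: superize_pos; first exact: blk_key_inj.
  move=> [j i] /eqP /= ->; apply/eqP; apply: contraT => wj.
  have : j \in [set j | w (j, ord_max) != 0] by rewrite inE.
  by rewrite E0 in_set0.
move: (jE); rewrite inE => wj.
pose B := blk_spare j; pose b : 'I_M * 'I_d.+3 := (j, ord_max).
pose w1 x := if x \in B then - w b else w x.
(* The [d + 1] spare letters just exceed the degree bound. *)
have cardB : (d < #|B|)%N.
  have iK (i : 'I_d.+1) : (inord i.+1 : 'I_d.+3) = i.+1 :> nat.
    by rewrite inordK // ltnS (leq_trans (ltn_ord i)).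
  have hI : injective (fun i : 'I_d.+1 => (j, inord i.+1 : 'I_d.+3)).
    move=> i i' /(congr1 (fun x => val x.2)) /=.
    by rewrite !iK => -[/val_inj].
  apply: (@leq_trans #|[set (j, inord i.+1 : 'I_d.+3) | i : 'I_d.+1]|).
    by rewrite card_imset ?card_ord.
  apply/subset_leq_card/subsetP => x /imsetP[i _ ->].
  by rewrite inE /= eqxx iK /= ltnS ltn_ord.
have bB : b \notin B by rewrite inE /= ltnn andbF.
have := incl_excl_diff (super_rel (@blk_key M) (@blk_neg M)) (@blk_neg M) w1 cardB.
rewrite (bigD1 set0) ?sub0set //= big1 ?addr0.
  rewrite cards0 mul1r => /eqP; rewrite subr_eq0 => /eqP.
  have w1E : zero_on w1 (B :\: set0) =1 w.
    move=> x; rewrite /zero_on setD0 /w1; case: (boolP (x \in B)) => // xB; by rewrite (wsp j).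
  by rewrite (eq_fill_sum _ w1E) (eq_super_pexp _ _ w1E).
move=> S /andP[sSB /set0Pn[y0 y0S]].
(* Choosing the largest kept letter leaves no letter of non-zero weight between it and [b]. *)
case: (arg_maxnP (@blk_key M) y0S) => y yS' ymax.
have yS : y \in S := yS'.
have yB := subsetP sSB _ yS.
set w2 := zero_on w1 (B :\: S).
have w2y : w2 y = - w2 b.
  by rewrite /w2 /zero_on !in_setD yS (negPf bB) andbF /= /w1 yB (negPf bB).
have ltyb : (blk_key y < blk_key b)%N.
  move: yB; rewrite inE => /andP[/eqP y1 /andP[_ y2]].
  by rewrite /blk_key y1 ltn_add2l.
have ny : ~~ blk_neg y.
  by move: yB; rewrite inE /blk_neg => /andP[_ /andP[_]]; apply: contraTneq => ->; rewrite ltnn.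
have nb : blk_neg b by rewrite /blk_neg eqxx.
rewrite (@fill_sum_cancel _ _ w2 y b key) //.
- rewrite (super_pexp_cancel _ ny nb w2y).
  have w3b j' : j' != j -> zero_on w2 [set y; b] (j', ord_max) = w (j', ord_max).
    move=> jj; have nB i : (j', i) \notin B by rewrite inE /= (negPf jj).
    rewrite {1}/zero_on in_set2 xpair_eqE (negPf jj) /= orbF ifN; last first.
      by apply: contraNneq (nB ord_max) => ->.
    by rewrite /w2 /zero_on in_setD (negPf (nB _)) andbF /w1 (negPf (nB _)).
  rewrite IHn ?subrr ?mulr0 //.
    apply: leq_trans leB; apply: proper_card; apply/properP; split.
      apply/subsetP => j'; rewrite !inE; case: (eqVneq j' j) => [->//|jj].
      by rewrite w3b.
    by exists j => //; rewrite inE /zero_on !inE eqxx orbT eqxx.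
  move=> j'; case: (eqVneq j' j) => [->|jj].
    by rewrite /zero_on !inE eqxx orbT eqxx.
  rewrite w3b // => wj' [j1 i1] xs; have xs' := xs.
  move: xs; rewrite inE /= => /andP[/eqP ej _]; subst j1.
  rewrite /zero_on; case: ifP => // _; rewrite /w2 /zero_on; case: ifP => // _.
  by rewrite /w1 inE /= (negPf jj) /=; apply: (wsp j').
- by rewrite /super_rel ltnn eqxx.
- by rewrite /super_rel ltnNge ltnW //= negb_and (ltn_eqF ltyb).
- by rewrite /super_rel ltyb.
- by rewrite /super_rel ltnn eqxx.
move=> z zy zb wz.
have key_ne : blk_key z <> blk_key y /\ blk_key z <> blk_key b.
  by split=> /blk_key_inj/eqP; rewrite ?(negPf zy) ?(negPf zb).
have notbtw : ~ (blk_key y < blk_key z < blk_key b)%N.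
  move=> /andP[lt1 lt2].
  have zB : z \in B.
    move: yB; rewrite !inE => /andP[/eqP y1 /andP[y2 _]].
    have z1 : (z.1 = j :> nat).
      have lt2' : (blk_key z < j.+1 * d.+3)%N.
        by rewrite (ltn_trans lt2) // /blk_key /= mulSn addnC ltn_add2r.
      have le1 : (j * d.+3 <= blk_key z)%N by rewrite (leq_trans _ (ltnW lt1)) // /blk_key y1 leq_addr.
      have zE : (blk_key z %/ d.+3 = z.1)%N by rewrite /blk_key divnMDl // divn_small // addn0.
      apply/eqP; rewrite eqn_leq -zE leq_divRL // le1 andbT.
      by rewrite -ltnS ltn_divLR.
    have z1' : z.1 = j by apply: val_inj.
    rewrite z1' eqxx /=; move: lt1 lt2; rewrite /blk_key /= y1 z1' !ltn_add2l => lt1 ->.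
    by rewrite (leq_ltn_trans _ lt1).
  case/eqP: wz; rewrite /w2 /zero_on ifT // inE zB andbT.
  by apply/negP => /ymax; rewrite /= leqNgt lt1.
rewrite /super_rel; move: key_ne notbtw ltyb.
move: (blk_key z) (blk_key y) (blk_key b) (blk_neg z) (blk_neg y) (blk_neg b).
by clear=> kz ky kb nz ny nb; lia.
Qed.

End Main.
End Superization.

(** * Power-sum expansions over a field of characteristic zero *)

Lemma Qqt_natr_neq0 n : (n.+1)%:R != 0 :> Qqt.
Proof.
rewrite -(rmorph_nat (@FracField.tofrac {mpoly rat[2]})) tofrac_eq0.
by rewrite -mpolyC_nat mpolyC_eq0 Num.Theory.pnatr_eq0.
Qed.

Lemma mpoly_Qqt_char_neq2 N (x : {mpoly Qqt[N]}) : x = - x -> x = 0.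
Proof.
move=> e; have : (2%:R : Qqt) *: x = 0 by rewrite scaler_nat mulr2n {1}e addNr.
by move/eqP; rewrite scaler_eq0 (negPf (Qqt_natr_neq0 1)) => /eqP.
Qed.

Section PowerSumExpansion.
Variable N : nat.
Implicit Types (f g : {mpoly Qqt[N]}).

Definition psum_spanned (d : nat) f : Prop :=
  exists s, psum_expansion d s f.

Lemma psum_spanned0 d : psum_spanned d 0.
Proof. by exists [::]; split; rewrite // big_nil. Qed.

Lemma psum_spannedD d f g :
  psum_spanned d f -> psum_spanned d g -> psum_spanned d (f + g).
Proof.
case=> s [ps ->] [s' [ps' ->]]; exists (s ++ s'); split; last by rewrite big_cat.
by rewrite all_cat ps.
Qed.

Lemma psum_spannedZ d c f : psum_spanned d f -> psum_spanned d (c *: f).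
Proof.
case=> s [ps ->]; exists [seq (c * x.1, x.2) | x <- s]; split.
  by rewrite all_map; apply: sub_all ps.
by rewrite big_map scaler_sumr; apply: eq_bigr => x _; rewrite scalerA.
Qed.

Lemma psum_spanned_sum d (J : Type) (r : seq J) (P : pred J) (F : J -> {mpoly Qqt[N]}) :
  (forall i, P i -> psum_spanned d (F i)) ->
  psum_spanned d (\sum_(i <- r | P i) F i).
Proof.
by move=> H; apply: big_ind => //; [apply: psum_spanned0 | apply: psum_spannedD].
Qed.

Lemma geq_trans : transitive geq.
Proof. by move=> a b c ba ac; apply: leq_trans ac ba. Qed.

Lemma geq_total : total geq.
Proof. by move=> a b; apply: leq_total. Qed.

Lemma psum_spannedM d a f : (0 < a)%N ->
  psum_spanned d f -> psum_spanned (a + d) (psum N a * f).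
Proof.
move=> a0 [s [/allP ps ->]]; exists [seq (x.1, sort geq (a :: x.2)) | x <- s]; split.
  rewrite all_map; apply/allP => x /ps /andP[/andP[_ xpos] /eqP sx] /=.
  rewrite /is_partition_of /is_partition sort_sorted; last exact: geq_total.
  have pe : perm_eq (sort geq (a :: x.2)) (a :: x.2) by rewrite perm_sort.
  by rewrite (perm_all _ pe) /= a0 xpos /= (perm_sumn pe) /= sx.
rewrite big_map mulr_sumr; apply: eq_bigr => x _ /=.
rewrite -scalerAr; congr (_ *: _); rewrite /psum_part.
have pe : perm_eq (sort geq (a :: x.2)) (a :: x.2) by rewrite perm_sort.
by rewrite (perm_big _ pe) /= big_cons.
Qed.

(** A positive integer multiple of the monomial symmetric polynomial with exponents [m]; summing
    over all permutations avoids stabilizers. *)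
Definition perm_sum (m : 'I_N -> nat) : {mpoly Qqt[N]} :=
  \sum_(s : 'S_N) \prod_i 'X_(s i) ^+ m i.

Lemma eq_perm_sum m m' : m =1 m' -> perm_sum m = perm_sum m'.
Proof. by move=> e; apply: eq_bigr => s _; apply: eq_bigr => i _; rewrite e. Qed.

Lemma perm_sum_perm m (p : 'S_N) : perm_sum (fun i => m (p i)) = perm_sum m.
Proof.
rewrite /perm_sum [RHS](reindex_inj (mulgI p^-1%g)) /=; apply: eq_bigr => s _.
rewrite [RHS](reindex_inj (@perm_inj _ p)) /=; apply: eq_bigr => i _.
by rewrite permM permK.
Qed.

Lemma psum_mul_perm_sum a m :
  psum N a * perm_sum m = \sum_j perm_sum (fun i => m i + (i == j) * a)%N.
Proof.
rewrite /perm_sum mulr_sumr [RHS]exchange_big /=; apply: eq_bigr => s _.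
have -> : psum N a = \sum_j 'X_(s j) ^+ a by exact: (reindex_inj (@perm_inj _ s)).
rewrite mulr_suml; apply: eq_bigr => j _ /=.
under [RHS]eq_bigr do rewrite exprD.
rewrite big_split /= mulrC; congr (_ * _).
rewrite (bigD1 j) //= eqxx mul1n big1 ?mulr1 // => i /negPf ->.
by rewrite expr0.
Qed.

(** Induction on the number of non-zero exponents. Take one exponent [a] out of [m] and multiply the
    remaining sum by [psum N a]. Placing [a] on an empty position gives back [perm_sum m]; placing
    it on an occupied one leaves fewer non-zero exponents. Solving for [perm_sum m] divides by the
    number of empty positions. *)
Lemma psum_spanned_perm_sum (m : 'I_N -> nat) :
  psum_spanned (\sum_i m i)%N (perm_sum m).
Proof.
have [n] := ubnP (#|[set i | (0 < m i)%N]|).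
elim: n m => // n IHn m; rewrite ltnS => le_n.
case: (set_0Vmem [set i | (0 < m i)%N]) => [E0|[i0]].
  have m0 i : m i = 0%N.
    apply/eqP; rewrite eqn0Ngt; apply/negP => mi.
    have : i \in [set i | (0 < m i)%N] by rewrite inE.
    by rewrite E0 in_set0.
  exists [:: ((#|'S_N|)%:R, [::])]; split.
    by rewrite /= /is_partition_of /= big1.
  rewrite big_seq1 /psum_part big_nil /perm_sum.
  rewrite (eq_bigr (fun=> 1)) => [|s _]; last by rewrite big1 // => i _; rewrite m0 expr0.
  by rewrite sumr_const scaler_nat; congr (_ *+ _); apply: eq_card.
rewrite inE => mi0; pose a := m i0.
pose m' i := if i == i0 then 0%N else m i.
pose mj j i := (m' i + (i == j) * a)%N.
have m'E : (\sum_i m i = a + \sum_i m' i)%N.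
  rewrite (bigD1 i0) //= [in RHS](bigD1 i0) //= {1}/m' eqxx add0n; congr (_ + _)%N.
  by apply: eq_bigr => i /negPf ni; rewrite /m' ni.
have sumj j : (\sum_i mj j i = \sum_i m i)%N.
  rewrite m'E big_split /= addnC; congr (_ + _)%N.
  by rewrite (bigD1 j) //= eqxx mul1n big1 ?addn0 // => i /negPf ->.
have m'lt : (#|[set i | (0 < m' i)%N]| < #|[set i | (0 < m i)%N]|)%N.
  apply: proper_card; apply/properP; split.
    by apply/subsetP => i; rewrite !inE /m'; case: eqP.
  by exists i0; rewrite inE // /m' eqxx.
have eqj j : m' j == 0%N -> perm_sum (mj j) = perm_sum m.
  move=> /eqP m'j; rewrite -(perm_sum_perm m (tperm i0 j)); apply: eq_perm_sum => i.
  rewrite /mj; case: tpermP => [->|->|/eqP ii0 /eqP ij].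
  - rewrite {1}/m' eqxx add0n; case: (eqVneq i0 j) => [<-|i0j]; first by rewrite mul1n.
    by rewrite mul0n -m'j /m' eq_sym (negPf i0j).
  - by rewrite m'j eqxx mul1n.
  - by rewrite (negPf ij) mul0n addn0 /m' (negPf ii0).
have := psum_mul_perm_sum a m'; rewrite (bigID (fun j => m' j == 0%N)) /=.
rewrite (eq_bigr (fun=> perm_sum m)); last by move=> j; apply: eqj.
rewrite sumr_const; set c := #|_|.
(* [i0] itself is an empty position of [m']. *)
have c0 : (0 < c)%N by apply/card_gt0P; exists i0; rewrite unfold_in /m' eqxx.
set R := (X in _ = _ + X) => e.
have : perm_sum m *+ c = psum N a * perm_sum m' - R by rewrite e addrK.
move/(congr1 (fun f => (c%:R : Qqt)^-1 *: f)).
rewrite -scaler_nat scalerA mulVf ?scale1r; last by case: (c) c0 => // c' _; apply: Qqt_natr_neq0.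
move=> ->; apply: psum_spannedZ; apply: psum_spannedD.
  by rewrite m'E; apply: psum_spannedM => //; apply: IHn; apply: leq_trans le_n.
rewrite -scaleN1r; apply: psum_spannedZ; apply: psum_spanned_sum => j m'j.
rewrite -(sumj j); apply: IHn; apply: leq_trans le_n; apply: leq_ltn_trans m'lt.
apply/subset_leq_card/subsetP => i; rewrite !inE /mj.
case: (eqVneq i j) => [-> _|_]; last by rewrite mul0n addn0.
by rewrite lt0n.
Qed.

(** Averaging over the symmetric group turns each monomial of [f] into a multiple of a
    [perm_sum]. *)
Lemma sym_psum_spanned d f : f \is symmetric ->
  (forall m, m \in msupp f -> mdeg m = d) -> psum_spanned d f.
Proof.
move=> /issymP fs fd; set c := #|'S_N|.
have c0 : (c%:R : Qqt) != 0.
  have : (0 < c)%N by apply/card_gt0P; exists 1%g; rewrite inE.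
  by case: (c) => // c' _; apply: Qqt_natr_neq0.
have fE : c%:R *: f = \sum_(s : 'S_N) msym s f.
  rewrite (eq_bigr (fun=> f)) => [|s _]; last exact: fs.
  by rewrite sumr_const scaler_nat; congr (_ *+ _); apply: eq_card => s; rewrite inE.
have -> : f = c%:R^-1 *: \sum_(m <- msupp f) f@_m *: perm_sum (m : 'X_{1..N}).
  rewrite -[LHS](scalerK c0) fE; congr (_ *: _).
  under eq_bigr => s _ do rewrite [in msym s f](mpolyE f) linear_sum /=.
  rewrite exchange_big /=; apply: eq_bigr => m _.
  rewrite /perm_sum scaler_sumr; apply: eq_bigr => s _.
  by rewrite linearZ /=; congr (_ *: _); rewrite /msym mmapX /mmap1.
apply: psum_spannedZ; rewrite big_seq; apply: psum_spanned_sum => m /fd <-.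
by apply: psum_spannedZ; rewrite mdegE; apply: psum_spanned_perm_sum.
Qed.

End PowerSumExpansion.

(** * Monomial expansion of symmetric polynomials *)

Section MonomialExpansion.
Variable N : nat.

Definition mpart (m : 'X_{1..N}) : seq nat :=
  sort geq [seq x <- [seq m i | i <- enum 'I_N] | (0 < x)%N].

Lemma sumn_mpart m : sumn (mpart m) = mdeg m.
Proof.
have pe : perm_eq (mpart m) [seq x <- [seq m i | i <- enum 'I_N] | (0 < x)%N].
  by rewrite perm_sort.
rewrite (perm_sumn pe) sumnE big_filter big_map big_enum_cond mdegE /=.
rewrite [RHS](bigID (fun i => 0 < m i)%N) /= [X in (_ + X)%N]big1 ?addn0.
  by apply: eq_bigl => i.
by move=> i; rewrite -eqn0Ngt => /eqP.
Qed.

Lemma is_partition_mpart m : is_partition_of (mdeg m) (mpart m).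
Proof.
rewrite /is_partition_of sumn_mpart eqxx andbT /is_partition sort_sorted /=; last exact: geq_total.
by rewrite all_sort filter_all.
Qed.

(** Equal non-zero exponents and equal length force equally many zeros, so the exponent vectors are
    rearrangements of each other. *)
Lemma mpart_eq_perm (m m' : 'X_{1..N}) : mpart m = mpart m' ->
  exists s : 'S_N, m' = [multinom m (s i) | i < N].
Proof.
move=> e.
have pe : perm_eq [tuple m' i | i < N] [tuple m i | i < N].
  have tE (n : 'X_{1..N}) : [tuple n i | i < N] = [seq n i | i <- enum 'I_N] :> seq nat.
    by rewrite /= enumT.
  rewrite !tE; set l' := map _ _; set l := map _ _.
  have pf : perm_eq [seq x <- l' | (0 < x)%N] [seq x <- l | (0 < x)%N].
    apply/(perm_sortP geq_total geq_trans); last by symmetry.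
    by move=> a b /andP[ab ba]; apply/eqP; rewrite eqn_leq; apply/andP; split.
  have sz : size l' = size l by rewrite !size_map.
  have zE (r : seq nat) : [seq x <- r | ~~ (0 < x)%N] = nseq (count (fun x => ~~ (0 < x)%N) r) 0%N.
    elim: r => //= x r ->; by case: x.
  rewrite -(perm_filterC (fun x => 0 < x)%N l') perm_sym.
  rewrite -(perm_filterC (fun x => 0 < x)%N l) perm_sym.
  apply: perm_cat => //; rewrite !zE.
  have := count_predC (fun x => 0 < x)%N l; rewrite -sz -(count_predC (fun x => 0 < x)%N l').
  by rewrite -!size_filter (perm_size pf) => /eqP; rewrite eqn_add2l !size_filter => /eqP <-.
case/tuple_permP: pe => s sE.
exists s; apply/mnmP => i; rewrite mnmE.
have := congr1 (fun r => nth 0%N r i) sE.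
rewrite -[LHS]/(nth 0%N [tuple m' i | i < N] i) -tnth_nth tnth_mktuple => ->.
rewrite -[LHS]/(nth 0%N [tuple tnth [tuple m j | j < N] (s j) | j < N] i).
by rewrite -tnth_nth !tnth_mktuple.
Qed.

Lemma mcoeff_msym_part (mu : seq nat) (m : 'X_{1..N}) :
  (msym_part N mu)@_m = (mpart m == mu)%:R.
Proof.
rewrite /msym_part raddf_sum /=.
under eq_bigr do rewrite mcoeffX.
case: (eqVneq (mpart m) mu) => [e|ne].
  have dm : (mdeg m < (sumn mu).+1)%N by rewrite -e sumn_mpart.
  rewrite (bigD1 (BMultinom dm)) /=; last by rewrite -e.
  rewrite eqxx big1 ?addr0 // => m' /andP[_]; rewrite -val_eqE /=.
  by move/negPf->.
apply: big1 => m' e; case: eqP => // e'; case/eqP: ne; rewrite -e'; exact/eqP.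
Qed.

(** Symmetry makes coefficients constant on monomials with the same sorted exponents; the value is
    read off at the first such monomial of the support. *)
Lemma sym_msym_part_expansion (f : {mpoly Qqt[N]}) : f \is symmetric ->
  f = \sum_(mu <- undup [seq mpart m | m <- msupp f])
        f@_(nth 0%MM (msupp f) (index mu [seq mpart m | m <- msupp f])) *: msym_part N mu.
Proof.
move=> /issymP fs; set P := map _ _.
have fE m m' : mpart m = mpart m' -> f@_m = f@_m'.
  by move=> /mpart_eq_perm[s ->]; rewrite -{1}(fs s) mcoeff_sym.
apply/mpolyP => m; rewrite raddf_sum /=.
under eq_bigr do rewrite mcoeffZ mcoeff_msym_part.
have [mP|mP] := boolP (mpart m \in P); last first.
  rewrite big_seq big1 => [|mu].
    by apply/eqP; rewrite mcoeff_eq0; apply: contra mP => ?; apply: map_f.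
  rewrite mem_undup => muP; case: eqP => [e|_]; last by rewrite mulr0.
  by rewrite e muP in mP.
rewrite (bigD1_seq (mpart m)) ?mem_undup ?undup_uniq //= eqxx mulr1 big1 ?addr0.
  apply: fE; rewrite -(nth_map 0%MM [::]) ?nth_index //.
  by rewrite -(size_map mpart) index_mem.
by move=> mu; rewrite eq_sym => /negPf ->; rewrite mulr0.
Qed.

Lemma sym_psum m : psum N m \is symmetric.
Proof.
apply/issymP => s; rewrite /psum rmorph_sum /= [RHS](reindex_inj (@perm_inj _ s)) /=.
by apply: eq_bigr => i _; rewrite rmorphXn /= /msym mmapX mmap1U.
Qed.

Lemma sym_pleth_tm1 s : pleth_tm1 N s \is symmetric.
Proof.
apply: rpred_sum => x _; apply: rpredZ; apply: rpred_prod => m _; exact: sym_psum.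
Qed.

End MonomialExpansion.

(** * Cells of the diagram *)

Section Diagram.
Variable la : seq nat.
Local Notation H := (head 0%N la).
Local Notation k := (size la).

Definition dg : {pred 'I_H * 'I_k} := [pred c : 'I_H * 'I_k | in_dg la c.1.+1 c.2.+1].
(** With cells as a finite type, super fillings are total functions. [row] and [col] count from 0,
    whereas [in_dg] counts from 1. *)
Definition cell : finType := {c : 'I_H * 'I_k | c \in dg}.
Definition row (c : cell) : nat := (val c).1.
Definition col (c : cell) : nat := (val c).2.

Lemma cellP (c : cell) : in_dg la (row c).+1 (col c).+1.
Proof. exact: (valP c). Qed.

Lemma in_dgE r i : in_dg la r.+1 i.+1 = (i < k)%N && (r < nth 0%N la i)%N.
Proof. by []. Qed.

Lemma cell_inj (c c' : cell) : row c = row c' -> col c = col c' -> c = c'.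
Proof.
move=> er ec; apply: val_inj; move: er ec; rewrite /row /col.
by case: (val c) (val c') => [a b] [a' b'] /= /val_inj -> /val_inj ->.
Qed.

Section Cells.
Hypothesis pla : is_partition la.

Lemma nth_le_head i : (nth 0%N la i <= H)%N.
Proof.
have [ik|ik] := ltnP i k; last by rewrite nth_default.
rewrite -nth0; case/andP: pla => srt _.
apply: (@sorted_leq_nth _ geq geq_trans leqnn 0%N la srt 0%N i) => //.
by rewrite inE (leq_trans _ ik).
Qed.

Lemma cell_exists r i : in_dg la r.+1 i.+1 ->
  exists c : cell, row c = r /\ col c = i.
Proof.
move=> ri; have := ri; rewrite in_dgE => /andP[ik rl].
have rH : (r < H)%N by apply: leq_trans rl (nth_le_head i).
by exists (exist _ (Ordinal rH, Ordinal ik) ri : cell).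
Qed.

End Cells.

Lemma big_cell (R : Type) (idx : R) (op : Monoid.com_law idx) (F : nat -> nat -> R) :
  \big[op/idx]_(c : cell) F (row c) (col c) =
  \big[op/idx]_(i < k) \big[op/idx]_(r < H | in_dg la r.+1 i.+1) F r i.
Proof.
rewrite -(big_sub dg (fun c : 'I_H * 'I_k => F c.1 c.2)).
by rewrite [RHS](exchange_big_dep xpredT) //= pair_big_dep.
Qed.

(** * Pair weights and the reading order *)

Section Weights.

(** Attacking pairs oriented along the reading order, [v] before [u]. *)
Definition cell_att (v u : cell) : bool :=
  ((row v == row u) && (col v < col u)%N) ||
  ((row u == (row v).+1) && (col u < col v)%N).
Definition cell_below (v u : cell) : bool :=
  (row u == (row v).+1) && (col u == col v).
Definition cell_arm (v : cell) : nat :=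
  \sum_(c : cell | (row c == row v) && (col v < col c)%N) 1.
(** The division by a power of [tt_] comes from the term I(a, b) of the triple identity, which
    occurs once for every cell to the right of the lower cell [v]. *)
Definition cell_wt (v u : cell) : Qqt :=
  if cell_att v u then tt_
  else if cell_below v u then
    qq ^+ (leg la (row u).+1 (col u).+1).+1 / tt_ ^+ cell_arm v
  else 1.
Definition cell_key (c : cell) : nat := (row c * k + col c)%N.

Lemma cell_key_inj : injective cell_key.
Proof.
move=> c c'; rewrite /cell_key => E.
have [lt lt'] : (col c < k)%N /\ (col c' < k)%N by split; rewrite /col ltn_ord.
have k0 : (0 < k)%N by apply: leq_trans lt.
apply: cell_inj.
  have := congr1 (divn^~ k) E; rewrite /= !divnMDl // !divn_small // !addn0 //.
by have := congr1 (modn^~ k) E; rewrite /= !modnMDl !modn_small.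
Qed.

Lemma cell_wt_neq1 v u : cell_wt v u != 1 -> cell_att v u || cell_below v u.
Proof. by rewrite /cell_wt; case: cell_att => //; case: cell_below => //; rewrite eqxx. Qed.

Lemma cell_key_lt (v u : cell) : (cell_key v < cell_key u)%N =
  (row v < row u)%N || ((row v == row u) && (col v < col u)%N).
Proof.
rewrite /cell_key; have [lt lt'] : (col v < k)%N /\ (col u < k)%N by split; rewrite /col ltn_ord.
case: (ltngtP (row v) (row u)) => [ltr|gtr|->] /=; last by rewrite ltn_add2l.
- by have := leq_mul2r k (row v).+1 (row u); rewrite ltr orbT mulSn; lia.
- by have := leq_mul2r k (row u).+1 (row v); rewrite gtr orbT mulSn; lia.
Qed.

Lemma cell_wt_key v u : cell_wt v u != 1 -> (cell_key v < cell_key u)%N.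
Proof.
move=> /cell_wt_neq1; rewrite cell_key_lt /cell_att /cell_below.
by move: (row v) (row u) (col v) (col u) => rv ru cv cu; lia.
Qed.

(* Strictly between a cell and the cell below it, reading rows from the bottom
   up and each row from left to right, any two cells attack each other. *)
Lemma cell_att_nested (v u v' u' : cell) :
  cell_att v u || cell_below v u -> (v', u') != (v, u) ->
  (cell_key v <= cell_key v')%N -> (cell_key v' < cell_key u')%N ->
  (cell_key u' <= cell_key u)%N -> cell_att v' u'.
Proof.
move=> vu ne; rewrite (leqNgt (cell_key v)) (leqNgt (cell_key u')) !cell_key_lt => le1 lt le2.
have ne' : ~ [/\ row v' = row v, col v' = col v, row u' = row u & col u' = col u].
  case=> rv cv ru cu; case/eqP: ne; by rewrite (cell_inj rv cv) (cell_inj ru cu).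
move: vu ne' le1 lt le2; rewrite /cell_att /cell_below.
move: (row v) (row u) (col v) (col u) (row v') (row u') (col v') (col u').
move=> rv ru cv cu rv' ru' cv' cu' vu ne' le1 lt le2.
have : ~ (rv' = rv /\ cv' = cv /\ ru' = ru /\ cu' = cu) by case=> ? [? [? ?]]; apply: ne'.
by clear ne' ne; move: vu le1 lt le2; lia.
Qed.

Lemma tt_neq0 : tt_ != 0.
Proof. by rewrite /tt_ tofrac_eq0 -msupp_eq0 msuppX. Qed.

End Weights.

End Diagram.

(** * Super fillings as functions on cells *)

Section Fillings.
Variables (la : seq nat) (N : nat).
Hypothesis pla : is_partition la.
Local Notation cell := (cell la).
Local Notation filling := {ffun cell -> 'I_N * bool}.

Definition grid_of (s : filling) : gridT la N := [ffun c => omap s (insub c)].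

Lemma grid_of_val s (c : cell) : grid_of s (val c) = Some (s c).
Proof. by rewrite ffunE valK. Qed.

Lemma grid_of_out s c : c \notin @dg la -> grid_of s c = None.
Proof. by move=> cd; rewrite ffunE insubN. Qed.

Lemma is_filling_grid_of s : is_filling (grid_of s).
Proof.
apply/forallP => c; have [cd|cd] := boolP (c \in @dg la).
  by rewrite (grid_of_val s (exist _ c cd : cell)) eq_sym; apply/eqP.
by rewrite grid_of_out // eq_sym; apply/eqP/negbTE.
Qed.

Lemma grid_of_inj : injective grid_of.
Proof.
move=> s s' e; apply/ffunP => c.
by apply: Some_inj; rewrite -!grid_of_val e.
Qed.

Lemma grid_of_surj (F : gridT la N) : is_filling F -> exists s, F = grid_of s.
Proof.
move=> /forallP Ff.
have /fin_all_exists[s sE] (c : cell) : exists x, F (val c) = Some x.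
  have := Ff (val c); rewrite [in_dg _ _ _](valP c); case: (F _) => // x _.
  by exists x.
exists [ffun c => s c]; apply/ffunP => c; have [cd|cd] := boolP (c \in @dg la).
  by rewrite (grid_of_val _ (exist _ c cd : cell)) ffunE -sE.
rewrite grid_of_out //; have := Ff c; rewrite [in_dg _ _ _](negbTE cd).
by case: (F c).
Qed.

Lemma sum_fillings (V : nmodType) (P : pred (gridT la N)) (G : gridT la N -> V) :
  \sum_(F | is_filling F && P F) G F = \sum_(s | P (grid_of s)) G (grid_of s).
Proof.
rewrite (eq_bigl (fun F => (F \in grid_of @: [set: filling]) && P F)); last first.
  move=> F; congr (_ && _); apply/idP/imsetP => [/grid_of_surj[s ->]|[s _ ->]].
    by exists s; rewrite ?inE.
  exact: is_filling_grid_of.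
rewrite big_imset_cond /=; last by move=> s s' _ _; apply: grid_of_inj.
by apply: eq_bigl => s; rewrite inE.
Qed.

Lemma entry_grid_of s (c : cell) :
  entry (grid_of s) (row c).+1 (col c).+1 = ((s c).1.+1, (s c).2).
Proof.
rewrite /entry cellP /= !valK -surjective_pairing grid_of_val.
by case: (s c).
Qed.

Lemma entry_out s r i : ~~ in_dg la r i -> entry (grid_of s) r i = zero_letter.
Proof. by rewrite /entry => /negbTE ->. Qed.

Definition letter_rel : rel ('I_N * bool) :=
  super_rel (fun x : 'I_N * bool => val x.1) (fun x : 'I_N * bool => x.2).

Lemma IndE a b : Ind a b = (b.1 < a.1)%N || ((a.1 == b.1) && a.2).
Proof.
case: a b => [a sa] [b sb]; rewrite /Ind /lt1 /= xpair_eqE.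
by case: (ltngtP a b) => //= _; case: sa; case: sb.
Qed.

(** I and its negation are both transitive, so the three indicators in [quinv_triple] never sum to 0
    or 3, and the triple indicator is 2 minus their sum. *)
Lemma quinv_tripleE a b c :
  (quinv_triple a b c + Ind a b = Ind c b + Ind a c)%N.
Proof.
rewrite /quinv_triple !IndE; move: a b c => [a sa] [b sb] [c sc] /=.
by case: sa; case: sb; case: sc; case: (ltngtP a b); case: (ltngtP b c); case: (ltngtP a c) => //=; lia.
Qed.

(** * The statistics [maj] and [quinv] as sums over pairs of cells *)

Section Stat.
Variable s : filling.
Local Notation E := (entry (grid_of s)).
Local Notation Lt c := (E (row c).+1 (col c).+1).
Local Notation J u v := (letter_rel (s u) (s v)).
Local Notation right b c := ((row c == row b) && (col b < col c)%N).

Lemma Ind_cells u v : Ind (Lt u) (Lt v) = J u v.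
Proof. by rewrite !entry_grid_of IndE /letter_rel /super_rel /= ltnS eqSS. Qed.

Lemma sum_below (u : cell) (f : cell -> nat) (g : nat) :
  (forall v, cell_below v u -> f v = g) ->
  (\sum_v cell_below v u * f v = (0 < row u) * g)%N.
Proof.
move=> fg; case ru: (row u) => [|r].
  by rewrite big1 // => v _; rewrite /cell_below ru.
have [|v [vr vc]] := @cell_exists la pla r (col u).
  by have := cellP u; rewrite !in_dgE ru => /andP[-> /ltnW].
have bv : cell_below v u by rewrite /cell_below ru vr vc !eqxx.
rewrite (bigD1 v) //= bv fg // big1 ?addn0 // => v' /eqP nv.
case: (boolP (cell_below v' u)) => // /andP[/eqP r' /eqP c']; case: nv.
by apply: cell_inj; [move: r'; rewrite ru vr => -[]|rewrite vc].
Qed.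

(** If no cell lies above [b], the entry read there is the zero letter, which is below every [x] of
    positive absolute value, so both sides vanish. *)
Lemma sum_above (b : cell) (x : letter) : (0 < x.1)%N ->
  (Ind (E (row b).+2 (col b).+1) x = \sum_a cell_below b a * Ind (Lt a) x :> nat)%N.
Proof.
move=> x0; have [ind|nind] := boolP (in_dg la (row b).+2 (col b).+1).
  have [a [ar ac]] := cell_exists pla ind.
  have ba : cell_below b a by rewrite /cell_below ar ac !eqxx.
  rewrite (bigD1 a) //= ba ar ac mul1n big1 ?addn0 // => a' /eqP na.
  case: (boolP (cell_below b a')) => // /andP[/eqP r' /eqP c']; case: na.
  by apply: cell_inj; rewrite ?r' ?c' ?ar ?ac.
rewrite entry_out // IndE /= big1.
  by case: x x0 => [[|x]].
move=> a _; case: (boolP (cell_below b a)) => // /andP[/eqP r' /eqP c'].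
by have := cellP a; rewrite r' c' (negPf nind).
Qed.

Lemma majE : maj (grid_of s) =
  (\sum_v \sum_u (cell_below v u && J u v) * (leg la (row u).+1 (col u).+1).+1)%N.
Proof.
pose G r i := ((0 < r) * (Ind (E r.+1 i.+1) (E r i.+1) * (leg la r.+1 i.+1).+1))%N.
have -> : (\sum_v \sum_u (cell_below v u && J u v) *
    (leg la (row u).+1 (col u).+1).+1 = \sum_(u : cell) G (row u) (col u))%N.
  rewrite exchange_big /=; apply: eq_bigr => u _.
  rewrite /G -(@sum_below u (fun v => J u v * (leg la (row u).+1 (col u).+1).+1)%N).
    by apply: eq_bigr => v _; rewrite mulnA mulnb.
  move=> v /andP[/eqP rv /eqP cv]; rewrite -Ind_cells.
  by rewrite -cv -rv.
rewrite (@big_cell la _ _ _ G) /maj big_add1 big_mkord; apply: eq_bigr => i _.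
(* With rows counted from 0, descents start in row 1, hence the guard [0 < r]. *)
rewrite big_add1 /= big_geq_mkord /=.
rewrite (big_ord_widen_cond (head 0%N la) (fun r => 0 < r)%N
   (fun r => if Ind (E r.+1 i.+1) (E r.+1.-1 i.+1) then (leg la r.+1 i.+1).+1 else 0)%N).
  rewrite [LHS]big_mkcond [RHS]big_mkcond; apply: eq_bigr => r _ /=.
  rewrite in_dgE ltn_ord /= /G /colh /=; case: (0 < r)%N; rewrite /= ?if_same //.
  by case: (r < _)%N => //; case: Ind; rewrite ?mul1n.
exact: nth_le_head.
Qed.

(** Degenerate triples need no separate case, since the entry above the top of a column is the zero
    letter. *)
Lemma quinvE : quinv (grid_of s) =
  (\sum_(b : cell) \sum_(c : cell) right b c * quinv_triple (E (row b).+2 (col b).+1) (Lt b) (Lt c))%N.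
Proof.
pose G r i r' j := (((r' == r) && (i < j)) *
   quinv_triple (E r.+2 i.+1) (E r.+1 i.+1) (E r'.+1 j.+1))%N.
rewrite [RHS](@big_cell la _ _ _ (fun r i => \sum_(c : cell) G r i (row c) (col c))%N).
rewrite /quinv big_add1 big_mkord; apply: eq_bigr => i _.
rewrite big_add1 /= big_geq_mkord /=.
under [RHS]eq_bigr do rewrite (@big_cell la _ _ _ (fun r j => G _ _ r j)).
rewrite [RHS]exchange_big /= [LHS]big_mkcond /=; apply: eq_bigr => j _.
rewrite [RHS]big_mkcond /= big_add1 big_mkord; case: ifPn => ij.
  apply: eq_bigr => r _; have [ri|ri] := boolP (in_dg la r.+1 i.+1) => //=.
  have [rj|rj] := boolP (in_dg la r.+1 j.+1) => /=.
    rewrite (bigD1 r) //= /G eqxx ij mul1n big1 ?addn0.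
      by case: ifPn => // nri; rewrite (entry_out s nri).
    by move=> r' /andP[_ nr]; rewrite val_eqE (negPf nr).
  rewrite big1 // => r' rj'; rewrite /G; case: eqP => // e.
  by rewrite e (negPf rj) in rj'.
rewrite big1 // => r _; case: ifP => // _; rewrite big1 // => r' _.
by rewrite /G (negPf ij) andbF.
Qed.

(** Sum the triple identity over [b] and the cells [c] to its right. The I(c, b) terms are the
    attacking pairs within a row, the I(a, c) terms those between adjacent rows, and each I(a, b)
    term recurs [cell_arm b] times. *)
Lemma quinv_inv :
  (quinv (grid_of s) + \sum_v \sum_u (cell_below v u && J u v) * cell_arm v =
   \sum_v \sum_u (cell_att v u && J u v))%N.
Proof.
have Lt0 (c : cell) : (0 < (Lt c).1)%N by rewrite entry_grid_of.
have -> : (\sum_v \sum_u (cell_below v u && J u v) * cell_arm v =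
    \sum_(b : cell) \sum_(c : cell) right b c * Ind (E (row b).+2 (col b).+1) (Lt b))%N.
  apply: eq_bigr => b _; rewrite -big_distrl /= -big_distrl /= mulnC.
  have -> : (cell_arm b = \sum_(c : cell) right b c)%N.
    by rewrite /cell_arm big_mkcond; apply: eq_bigr => c _; case: ifP.
  rewrite (sum_above b (Lt0 b)); congr (_ * _)%N.
  by apply: eq_bigr => a _; rewrite Ind_cells mulnb.
rewrite quinvE -big_split /=.
under eq_bigr => b _.
  rewrite -big_split /=.
  under eq_bigr do rewrite -mulnDr quinv_tripleE mulnDr.
  rewrite big_split /=.
  over.
rewrite big_split /=.
have -> : (\sum_(b : cell) \sum_(c : cell) right b c * Ind (E (row b).+2 (col b).+1) (Lt c) =
    \sum_(c : cell) \sum_(a : cell) ((row a == (row c).+1) && (col a < col c)) * J a c)%N.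
  rewrite exchange_big /=; apply: eq_bigr => c _.
  under eq_bigr => b _ do rewrite (sum_above b (Lt0 c)) big_distrr /=.
  rewrite exchange_big /=; apply: eq_bigr => a _.
  under eq_bigr do rewrite mulnA [(_ * cell_below _ _)%N]mulnC.
  rewrite -big_distrl /= Ind_cells; congr (_ * _)%N.
  rewrite (@sum_below a (fun b => right b c) ((row a == (row c).+1) && (col a < col c)%N)).
    by rewrite mulnb; case: eqP => [->|]; rewrite ?andbF.
  by move=> b /andP[/eqP -> /eqP ->]; rewrite eqSS eq_sym.
rewrite -big_split; apply: eq_bigr => v _; rewrite -big_split; apply: eq_bigr => u _ /=.
rewrite Ind_cells /cell_att; move: (J u v) (row v) (row u) (col v) (col u).
by move=> b rv ru cv cu; case: b; lia.
Qed.

Lemma stat_fill_wt : qq ^+ maj (grid_of s) * tt_ ^+ quinv (grid_of s) =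
  fill_wt (@cell_wt la) letter_rel s.
Proof.
(* [ar] is the total exponent of [tt_] in the denominators; multiplying by this power clears
   them. *)
set ar := (\sum_v \sum_u (cell_below v u && J u v) * cell_arm v)%N.
apply: (@mulIf _ (tt_ ^+ ar)); first by rewrite expf_neq0 // tt_neq0.
rewrite -mulrA -exprD quinv_inv majE /ar !expr_sum -!big_split; apply: eq_bigr => v _.
rewrite !expr_sum -!big_split; apply: eq_bigr => u _ /=.
rewrite /cell_wt; case: (J u v); rewrite ?andbF ?andbT ?mul0n ?expr0 ?mulr1 //.
have [at_|nat_] := boolP (cell_att v u).
  have -> : cell_below v u = false.
    move: at_; rewrite /cell_att /cell_below.
    by move: (row v) (row u) (col v) (col u) => rv ru cv cu; lia.
  by rewrite !mul0n !expr0 mulr1 mul1r expr1.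
case: cell_below; rewrite ?mul0n ?mul1n ?expr0 ?mulr1 //.
by rewrite divfK // expf_neq0 // tt_neq0.
Qed.

End Stat.
End Fillings.

(** * The two generating functions as sums over fillings *)

Section MacdonaldSums.
Variables (la : seq nat) (N : nat).
Hypothesis pla : is_partition la.
Local Notation cell := (cell la).
Local Notation filling := {ffun cell -> 'I_N * bool}.
Local Notation K := {mpoly Qqt[N]}.
Local Notation lrel := (@letter_rel N).

Lemma card_cell : #|cell| = sumn la.
Proof.
rewrite -sum1_card (@big_cell la _ _ _ (fun _ _ => 1%N)) sumnE (big_nth 0%N) big_mkord.
apply: eq_bigr => i _; rewrite -[RHS]card_ord -sum1_card.
rewrite (big_ord_widen (head 0%N la) (fun=> 1%N)); last exact: nth_le_head.
by apply: eq_bigl => r; rewrite in_dgE ltn_ord.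
Qed.

Definition cell_wtM (v u : cell) : K := (cell_wt v u)%:MP.

Lemma cell_wtM_neq1 v u : cell_wtM v u != 1 -> cell_wt v u != 1.
Proof. by apply: contraNneq => e; rewrite /cell_wtM e. Qed.

Lemma fill_wtM (L : finType) (I : rel L) s :
  fill_wt cell_wtM I s = (fill_wt (@cell_wt la) I s)%:MP.
Proof.
rewrite rmorph_prod; apply: eq_bigr => v _; rewrite rmorph_prod; apply: eq_bigr => u _.
by case: ifP => _ //; rewrite rmorph1.
Qed.

Lemma cell_wtM_nested :
  nested (@cell_key la) (tt_)%:MP [set: cell] cell_wtM.
Proof.
move=> v u _ _ /cell_wtM_neq1 vu; split; first exact: cell_wt_key.
move=> v' u' _ _ ne le1 lt le2; rewrite /cell_wtM /cell_wt.
by rewrite (cell_att_nested (cell_wt_neq1 vu) ne le1 lt le2).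
Qed.

(** Serves both permutations of the variables and substitutions for them. *)
Lemma fill_sum_rmorph (phi : {rmorphism K -> K}) (L : finType) (I : rel L) (w : L -> K) :
  (forall c, phi c%:MP = c%:MP) ->
  phi (fill_sum cell_wtM I w) = fill_sum cell_wtM I (fun x => phi (w x)).
Proof.
move=> phiC; rewrite rmorph_sum; apply: eq_bigr => s _.
by rewrite rmorphM fill_wtM phiC; congr (_ * _); rewrite rmorph_prod.
Qed.

Lemma big_grid_of (R : Type) (idx : R) (op : Monoid.com_law idx)
    (g : option ('I_N * bool) -> R) (s : filling) : g None = idx ->
  \big[op/idx]_c g (grid_of s c) = \big[op/idx]_(c : cell) g (Some (s c)).
Proof.
move=> g0; rewrite (bigID (fun c => c \in @dg la)) /= [X in op _ X]big1 ?Monoid.mulm1.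
  rewrite (big_sub (@dg la)); apply: eq_bigr => c _; by rewrite grid_of_val.
by move=> c cd; rewrite grid_of_out.
Qed.

Definition content (s : filling) : 'X_{1..N} := (\sum_(c : cell) U_((s c).1))%MM.

Lemma prod_cells_content (s : filling) : \prod_(c : cell) 'X_((s c).1) = 'X_[content s] :> K.
Proof. by rewrite /content (big_morph (fun m => 'X_[m]) (@mpolyXD _ _) (@mpolyX0 _ _)). Qed.

Lemma mdeg_content s : mdeg (content s) = sumn la.
Proof.
rewrite /content mdeg_sum (eq_bigr (fun=> 1%N)) => [|c _]; last by rewrite mdeg1.
by rewrite sum1_card card_cell.
Qed.

Lemma contentE s j : content s j = #|[set c : cell | (s c).1 == j]|.
Proof.
rewrite /content mnm_sumE -sum1_card [RHS]big_mkcond; apply: eq_bigr => c _.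
by rewrite mnm1E inE; case: eqP.
Qed.

Lemma xmon_grid_of (s : filling) : xmon (grid_of s) = 'X_[content s].
Proof.
rewrite -prod_cells_content /xmon.
rewrite (@big_grid_of _ _ _ (fun o => if o is Some (j, _) then 'X_j else 1)) //.
by apply: eq_bigr => c _; case: (s c).
Qed.

Lemma mneg_grid_of (s : filling) : mneg (grid_of s) = (\sum_(c : cell) (s c).2)%N.
Proof.
rewrite /mneg -sum1_card big_mkcond /=.
rewrite (@big_grid_of _ _ _ (fun o => if (if o is Some (_, true) then true else false) then 1 else 0)%N) //.
by apply: eq_bigr => c _; case: (s c) => j [].
Qed.

Lemma ppos_grid_of (s : filling) : ppos (grid_of s) = (\sum_(c : cell) ~~ (s c).2)%N.
Proof.
rewrite /ppos -sum1_card big_mkcond /=.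
rewrite (@big_grid_of _ _ _ (fun o => if (if o is Some (_, false) then true else false) then 1 else 0)%N) //.
by apply: eq_bigr => c _; case: (s c) => j [].
Qed.

Lemma all_positive_grid_of (s : filling) :
  all_positive (grid_of s) = [forall c, ~~ (s c).2].
Proof.
apply/forallP/forallP => sp c.
  by have := sp (val c); rewrite grid_of_val; case: (s c) => j [].
have [cd|cd] := boolP (c \in @dg la); last by rewrite grid_of_out.
have := sp (exist _ c cd : cell); rewrite (grid_of_val s (exist _ c cd : cell)).
by case: (s _) => j [].
Qed.

(** Giving negative letters weight zero in the super alphabet leaves the positive alphabet
    ['I_N]. *)
Lemma CmacE : Cmac la N = fill_sum cell_wtM (@ord_gt N) (fun j => 'X_j).
Proof.
pose w0 (x : 'I_N * bool) : K := if x.2 then 0 else 'X_(x.1).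
rewrite -[RHS](@fill_sum_embed _ _ cell_wtM _ _ _ lrel (fun j => (j, false)) w0); first last.
- move=> [j b]; rewrite /w0; case: b => //=; case/negP.
  exact: (codom_f (fun j : 'I_N => (j, false))).
- by move=> x y; rewrite /letter_rel /super_rel /= andbF orbF.
- by move=> x y [].
rewrite /Cmac sum_fillings // big_mkcond; apply: eq_bigr => s _.
rewrite all_positive_grid_of; case: forallP => [sp|/forallP].
  rewrite stat_fill_wt // fill_wtM -mul_mpolyC xmon_grid_of -prod_cells_content.
  by congr (_ * _); apply: eq_bigr => c _; rewrite /w0 (negPf (sp c)).
rewrite negb_forall => /existsP[c]; rewrite negbK => sc.
by rewrite (bigD1 c) //= {1}/w0 sc mul0r mulr0.
Qed.

Lemma Cmac_sym : Cmac la N \is symmetric.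
Proof.
apply/issymP => p; rewrite CmacE (@fill_sum_rmorph (msym p : {rmorphism K -> K})).
  rewrite -[RHS](fill_sum_perm _ p (@cell_key_inj la) cell_wtM_nested).
  by apply: eq_fill_sum => j; rewrite /= /msym mmapX mmap1U.
by move=> c; rewrite /= /msym mmapC.
Qed.

Lemma msupp_sum_monomials (P : pred filling) (a : filling -> Qqt) m :
  m \in msupp (\sum_(s | P s) a s *: 'X_[content s]) ->
  exists2 s, P s & content s = m.
Proof.
rewrite mcoeff_msupp raddf_sum /= => nz.
have [/existsP[s /andP[Ps /eqP e]]|nex] := boolP [exists s, P s && (content s == m)].
  by exists s.
case/eqP: nz; apply: big1 => s Ps; rewrite mcoeffZ mcoeffX; case: eqP => [e|_].
  by case/negP: nex; apply/existsP; exists s; rewrite Ps e eqxx.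
by rewrite mulr0.
Qed.

Lemma Cmac_homog m : m \in msupp (Cmac la N) -> mdeg m = sumn la.
Proof.
rewrite /Cmac sum_fillings //; under eq_bigr do rewrite xmon_grid_of.
move=> /(@msupp_sum_monomials (fun s => all_positive (grid_of s))
  (fun s => qq ^+ maj (grid_of s) * tt_ ^+ quinv (grid_of s)))[s _ <-].
exact: mdeg_content.
Qed.

(** Weights of the alphabet X(t-1): the two letters of absolute value x contribute [(t x)^m - x^m]
    to the superized power sum. *)
Definition super_var (x : 'I_N * bool) : K :=
  if x.2 then - 'X_(x.1) else tt_ *: 'X_(x.1).

Lemma super_filling_wt (s : filling) :
  ((-1) ^+ mneg (grid_of s) * qq ^+ maj (grid_of s) *
     tt_ ^+ (ppos (grid_of s) + quinv (grid_of s))) *: xmon (grid_of s) =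
  fill_wt cell_wtM lrel s * \prod_c super_var (s c).
Proof.
rewrite mneg_grid_of ppos_grid_of exprD fill_wtM -stat_fill_wt // xmon_grid_of.
rewrite -prod_cells_content mul_mpolyC !expr_sum.
have -> : \prod_c super_var (s c) =
   ((\prod_(c : cell) (-1) ^+ (s c).2) * \prod_(c : cell) tt_ ^+ (~~ (s c).2)) *:
     \prod_(c : cell) 'X_((s c).1).
  rewrite -big_split -scaler_prod; apply: eq_bigr => c _; rewrite /super_var.
  by case: (s c).2; rewrite /= ?expr0 ?expr1 ?mulr1 ?mul1r // scaleN1r.
by rewrite scalerA; congr (_ *: _); ring.
Qed.

Lemma non_attacking_grid_of (s : filling) :
  non_attacking (grid_of s) =
  [forall v, forall u, cell_att v u ==> ((s v).1 != (s u).1)].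
Proof.
apply/idP/forallP => [na v|na].
  apply/forallP => u; apply/implyP => vu.
  have rH (c : cell) : ((row c).+1 < (head 0%N la).+1)%N by rewrite ltnS ltn_ord.
  have ck (c : cell) : ((col c).+1 < (size la).+1)%N by rewrite ltnS ltn_ord.
  case/orP: vu => /andP[/eqP er ec].
    move/forallP: na => /(_ (Ordinal (ck v)))/forallP/(_ (Ordinal (ck u)))/forallP.
    move=> /(_ (Ordinal (rH v)))/forallP/(_ (Ordinal (rH u)))/implyP /=.
    by rewrite !cellP !entry_grid_of ltnS ec er eqxx /= => /(_ isT).
  move/forallP: na => /(_ (Ordinal (ck u)))/forallP/(_ (Ordinal (ck v)))/forallP.
  move=> /(_ (Ordinal (rH u)))/forallP/(_ (Ordinal (rH v)))/implyP /=.
  by rewrite !cellP !entry_grid_of ltnS ec er eqxx orbT /= eq_sym => /(_ isT).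
apply/forallP => i; apply/forallP => j; apply/forallP => r; apply/forallP => r'.
apply/implyP => /and5P[i0 ij ri rj rr].
move: ri rj rr ij i0.
case: (nat_of_ord i) => // {}i; case: (nat_of_ord j) => // {}j.
case: (nat_of_ord r) => [|{}r]; first by rewrite /in_dg /= andbF.
case: (nat_of_ord r') => [|{}r']; first by rewrite /in_dg /= andbF.
move=> /(cell_exists pla)[v [<- <-]] /(cell_exists pla)[u [<- <-]] rr; rewrite ltnS => ij _.
rewrite !entry_grid_of /= eqSS; case/orP: rr => [/eqP[er]|/eqP[er]].
  by have /forallP/(_ u)/implyP := na v; apply; rewrite /cell_att er eqxx ij.
have /forallP/(_ v)/implyP := na u; rewrite eq_sym; apply.
by rewrite /cell_att er eqxx ij orbT.
Qed.

(* Flipping the sign of the first cell that attacks a cell with the same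
   absolute value cancels the attacking super fillings. *)
Lemma attacking_cancel :
  \sum_(s : filling | ~~ non_attacking (grid_of s))
     fill_wt cell_wtM lrel s * \prod_c super_var (s c) = 0.
Proof.
pose bad (s : filling) u := [exists v, cell_att v u && ((s v).1 == (s u).1)].
pose fst (s : filling) u :=
  bad s u && [forall u', bad s u' ==> (cell_key u <= cell_key u')%N].
pose tg (s : filling) : filling :=
  [ffun u => if fst s u then ((s u).1, ~~ (s u).2) else s u].
have tg1 s u : (tg s u).1 = (s u).1 by rewrite ffunE; case: ifP.
have badE s u : bad (tg s) u = bad s u by apply: eq_existsb => v; rewrite !tg1.
have fstE s u : fst (tg s) u = fst s u.
  by rewrite /fst badE; congr (_ && _); apply: eq_forallb => v; rewrite badE.
have tgK : involutive tg.
  move=> s; apply/ffunP => u; rewrite ffunE fstE ffunE.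
  by case: (fst s u) => //=; rewrite negbK -surjective_pairing.
have naE s : ~~ non_attacking (grid_of s) = [exists u, bad s u].
  rewrite non_attacking_grid_of negb_forall; apply/existsP/existsP.
    case=> v; rewrite negb_forall => /existsP[u]; rewrite negb_imply negbK => vu.
    by exists u; apply/existsP; exists v.
  case=> u /existsP[v vu]; exists v; rewrite negb_forall; apply/existsP; exists u.
  by rewrite negb_imply negbK.
under eq_bigl do rewrite naE.
apply: mpoly_Qqt_char_neq2; rewrite [LHS](reindex_inj (inv_inj tgK)) /= -sumrN.
apply: eq_big => [s|s]; first by apply: eq_existsb => u; rewrite badE.
case/existsP=> u1; rewrite badE => u1bad.
case: (@arg_minnP cell u1 (bad s) (@cell_key la) u1bad) => u0 u0bad u0min.
have fstu u : fst s u = (u == u0).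
  apply/idP/eqP => [/andP[ub /forallP/(_ u0)]|->].
    by rewrite u0bad /= => le; apply: cell_key_inj; apply/eqP; rewrite eqn_leq le u0min.
  by rewrite /fst u0bad; apply/forallP => u'; apply/implyP; apply: u0min.
have tgE u : tg s u = if u == u0 then ((s u).1, ~~ (s u).2) else s u.
  by rewrite ffunE fstu.
have relE (x y : 'I_N * bool) : lrel x y = (y.1 < x.1)%N || ((x.1 == y.1) && x.2).
  by [].
(* Grouped by [u], the factor of a cell depends on its own sign but on no other, so the flip changes
   only the factor of [u0]. *)
have prodE (f : filling) : fill_wt cell_wtM lrel f * \prod_c super_var (f c) =
    \prod_u ((\prod_v (if lrel (f u) (f v) then cell_wtM v u else 1)) * super_var (f u)).
  by rewrite big_split /= /fill_wt exchange_big.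
rewrite !prodE (bigD1 u0) //= [in RHS](bigD1 u0) //= -mulNr; congr (_ * _); last first.
  apply: eq_bigr => u uu0; rewrite [in super_var _]tgE (negPf uu0); congr (_ * _).
  by apply: eq_bigr => v _; rewrite !relE tg1 tgE (negPf uu0).
under eq_bigr do rewrite relE tg1.
under [in RHS]eq_bigr do rewrite relE.
rewrite tgE eqxx /=.
have /existsP[v0 /andP[v0u0 /eqP ev0]] := u0bad.
have wv0 : cell_wtM v0 u0 = tt_%:MP by rewrite /cell_wtM /cell_wt v0u0.
pose R := \prod_(v | v != v0) (if ((s v).1 < (s u0).1)%N then cell_wtM v u0 else 1).
have key_v0 : (cell_key v0 < cell_key u0)%N.
  by move: v0u0; rewrite cell_key_lt /cell_att => /orP[->|/andP[/eqP-> _]]; rewrite ?orbT ?ltnSn.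
(* Among cells with the absolute value of [u0], only [v0] has a non-trivial weight with [u0]: by
   nesting, another one would attack or be attacked by [v0], giving a bad cell before [u0]. A
   negative sign at [u0] thus brings one factor [tt_], matching the [tt_] in the weight of a
   positive letter. *)
have prodR b : \prod_v (if ((s v).1 < (s u0).1)%N || (((s u0).1 == (s v).1) && b)
    then cell_wtM v u0 else 1) = (if b then tt_%:MP else 1) * R.
  rewrite (bigD1 v0) //= ev0 ltnn eqxx /= wv0; congr (_ * _).
  apply: eq_bigr => v vv0; case: ltnP => //= _.
  case: (eqVneq (s u0).1 (s v).1) => //= ev; case: b => //.
  apply/eqP; apply: contraT => /cell_wtM_neq1 vu.
  have key_v := cell_wt_key vu.
  have kne : cell_key v != cell_key v0 by apply: contra vv0 => /eqP/cell_key_inj ->.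
  have [ltv|gtv|eqv] := ltngtP (cell_key v) (cell_key v0); last by rewrite eqv eqxx in kne.
    have vv0att : cell_att v v0.
      apply: (cell_att_nested (cell_wt_neq1 vu)) => //; last exact: ltnW.
      by apply/eqP => -[e]; rewrite e ltnn in key_v0.
    have /u0min : bad s v0 by apply/existsP; exists v; rewrite vv0att -ev ev0 eqxx.
    by rewrite leqNgt key_v0.
  have v0vatt : cell_att v0 v.
    apply: (@cell_att_nested la v0 u0) => //; rewrite ?v0u0 //; last exact: ltnW.
    by apply/eqP => -[e]; rewrite e ltnn in key_v.
  have /u0min : bad s v by apply/existsP; exists v0; rewrite v0vatt -ev ev0 eqxx.
  by rewrite leqNgt key_v.
rewrite !prodR /super_var /=; case: (s u0).2; rewrite /= ?mul1r.
  by rewrite -mul_mpolyC; ring.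
by rewrite -mul_mpolyC; ring.
Qed.

Lemma CsuperE : Csuper la N = fill_sum cell_wtM lrel super_var.
Proof.
rewrite /Csuper sum_fillings // /fill_sum.
rewrite [RHS](bigID (fun s : filling => non_attacking (grid_of s))) /=.
rewrite attacking_cancel addr0.
by apply: eq_bigr => s _; rewrite super_filling_wt.
Qed.

End MacdonaldSums.

(** * Plethysm and the dominance bound *)

Section Plethysm.
Variables (la : seq nat) (N : nat).
Hypothesis pla : is_partition la.
Hypothesis leN : (sumn la <= N)%N.
Local Notation K := {mpoly Qqt[N]}.

(** Substituting arbitrary weights for the variables in the power-sum expansion gives the base case
    of superization. The signed alphabet embeds in the block alphabet with zero weight on spare
    letters, and there the superized power sum is [tt_ ^+ m - 1] times [psum N m]. *)
Lemma pleth_tm1_Csuper s : psum_expansion (sumn la) s (Cmac la N) ->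
  pleth_tm1 N s = Csuper la N.
Proof.
case=> /allP sp Cs.
pose s' : seq (K * seq nat) := [seq (x.1%:MP, x.2) | x <- s].
have s_pos : all (fun x => all (fun m => 0 < m)%N x.2) s'.
  by rewrite all_map; apply/allP => x /sp /andP[/andP[_ xp] _].
have s_size : all (fun x => size x.2 <= #|cell la|)%N s'.
  rewrite all_map; apply/allP => x /sp /andP[/andP[_ xp] /eqP sx] /=.
  rewrite (card_cell pla) -sx; elim: x.2 xp => //= m r IH /andP[m0 /IH le].
  by rewrite -add1n leq_add.
have base (w : 'I_N -> K) :
    fill_sum (@cell_wtM la N) (@ord_gt N) w = super_pexp s' xpred0 w.
  pose T := [tuple w i | i < N].
  have XT j : 'X_j \mPo T = w j.
    by rewrite comp_mpolyXU -tnth_nth tnth_mktuple.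
  have := congr1 (comp_mpoly T) Cs; rewrite CmacE //.
  rewrite (@fill_sum_rmorph la N (comp_mpoly T : {rmorphism K -> K})); last first.
    by move=> c; rewrite /= comp_mpolyC.
  rewrite (eq_fill_sum _ _ XT) => ->.
  rewrite /super_pexp big_map rmorph_sum; apply: eq_bigr => x _ /=.
  rewrite comp_mpolyZ -mul_mpolyC; congr (_ * _).
  rewrite /psum_part rmorph_prod; apply: eq_bigr => m _ /=.
  rewrite /psum rmorph_sum; apply: eq_bigr => i _ /=.
  by rewrite rmorphXn /= XT.
pose D := #|cell la|.
pose e (x : 'I_N * bool) : 'I_N * 'I_D.+3 := (x.1, if x.2 then ord_max else ord0).
pose w (z : 'I_N * 'I_D.+3) : K :=
  if z.2 == ord_max then - 'X_(z.1) else if z.2 == ord0 then tt_ *: 'X_(z.1) else 0.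
have eI : injective e by case=> [j b] [j' b'] [-> ]; case: b; case: b'.
have we x : w (e x) = super_var x by case: x => j []; rewrite /w /= ?eqxx.
have wout z : z \notin codom e -> w z = 0.
  case: z => j i; rewrite /w /=; case: eqP => [->|_] ze.
    by case/negP: ze; apply/codomP; exists (j, true).
  by case: eqP ze => [->|//] /negP[]; apply/codomP; exists (j, false).
rewrite CsuperE // -(eq_fill_sum _ _ we).
rewrite -(@fill_sum_embed _ _ _ _ _ _ (super_rel (@blk_key _ N) (@blk_neg _ N))) //; last first.
  move=> [j b] [j' b']; rewrite /letter_rel /super_rel /blk_key /blk_neg /e /=.
  have -> : ((if b then ord_max else ord0 : 'I_D.+3) == ord_max) = b by case: b; rewrite ?eqxx.
  have leB c : ((if c then ord_max else ord0 : 'I_D.+3) <= D.+2)%N by case: c.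
  have blt (a a' x x' : nat) :
      (x <= D.+2)%N -> (a < a')%N -> (a * D.+3 + x < a' * D.+3 + x')%N.
    move=> xD aa; apply: (@leq_trans (a.+1 * D.+3)); last by rewrite (leq_trans _ (leq_addr _ _)) // leq_mul2r aa orbT.
    by rewrite mulSn addnC ltn_add2r ltnS.
  case: (ltngtP j j') => [lt|gt|/val_inj ->] /=.
  - by rewrite ltnNge ltnW ?blt // (ltn_eqF (blt _ _ _ _ (leB b) lt)).
  - by rewrite blt.
  - by rewrite ltn_add2l eqn_add2l; case: b; case: b'; rewrite /= ?ltnn ?eqxx.
rewrite (@superize_blocks _ _ _ (@mpoly_Qqt_char_neq2 N) s' N (@cell_key la)) //.
- rewrite (@super_pexp_embed _ s' _ _ (fun x : 'I_N * bool => x.2) _ e) //; last by move=> [j []]; rewrite /blk_neg /= ?eqxx.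
  rewrite /super_pexp big_map; apply: eq_bigr => x _ /=.
  rewrite -mul_mpolyC mpolyCM -mulrA; congr (_ * _).
  rewrite rmorph_prod -big_split /=; apply: eq_bigr => m _.
  rewrite /super_psum /psum (eq_bigr (fun x => if x.2 then - 'X_(x.1) ^+ m
     else (tt_ ^+ m) *: 'X_(x.1) ^+ m)); last first.
    case=> j [] _; rewrite we /super_var /= ?opprK //.
    by rewrite exprZn.
  rewrite -(pair_bigA _ (fun j (b : bool) => if b then - 'X_j ^+ m else (tt_ ^+ m) *: 'X_j ^+ m)) /=.
  rewrite mulr_sumr; apply: eq_bigr => j _.
  by rewrite big_bool /= mpolyCB mpolyC1 mulrBl mul1r mul_mpolyC addrC.
- exact: cell_key_inj.
- by move=> v u /cell_wtM_neq1; apply: cell_wt_key.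
- by rewrite card_cell.
- move=> j _ [j' i]; rewrite inE /w /= => /andP[_ /andP[i0 i1]].
  by rewrite -!val_eqE /= (ltn_eqF i1) (gtn_eqF i0).
Qed.

Lemma sumn_take (r : seq nat) i :
  sumn (take i r) = (\sum_(j < size r | (j < i)%N) nth 0%N r j)%N.
Proof.
elim: r i => [|x r IH] [|i] /=; rewrite ?big_ord0 //; first by rewrite big_pred0.
by rewrite big_mkcond big_ord_recl /= -big_mkcond IH.
Qed.

(* Each row carries every absolute value at most once, so |J| letters occupy at
   most min(|J|, length) cells of a row. *)
Lemma non_attacking_count (s : {ffun cell la -> 'I_N * bool}) (J : {set 'I_N}) :
  non_attacking (grid_of s) ->
  (#|[set c | (s c).1 \in J]| <= sumn (take #|J| la))%N.
Proof.
rewrite non_attacking_grid_of // => /forallP na.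
have inj r : {in [set c : cell la | row c == r] &, injective (fun c => (s c).1)}.
  move=> v u; rewrite !inE => /eqP vr /eqP ur e.
  have sep (a b : cell la) : row a = r -> row b = r -> (col a < col b)%N ->
      (s a).1 = (s b).1 -> False.
    move=> ar br ab eab; have /forallP/(_ b)/implyP := na a.
    by rewrite /cell_att ar br eqxx ab eab eqxx => /(_ isT).
  apply: cell_inj; first by rewrite vr ur.
  by case: (ltngtP (col v) (col u)) => // lt; [case: (sep v u)|case: (sep u v)].
rewrite sumn_take; set i := #|J|.
(* The cells of the first [i] columns are counted row by row. *)
have -> : (\sum_(j < size la | (j < i)%N) nth 0%N la j =
   \sum_(r < head 0%N la) \sum_(j < size la | (j < i)%N && (r < nth 0%N la j)%N) 1)%N.
  rewrite (exchange_big_dep (fun j : 'I_(size la) => (j < i)%N)) /=; last by move=> r j _ /andP[].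
  apply: eq_bigr => j ji; rewrite -[LHS]card_ord -sum1_card.
  rewrite (big_ord_widen (head 0%N la) (fun=> 1%N)); last exact: nth_le_head.
  by apply: eq_bigl => r; rewrite ji.
rewrite -sum1_card (partition_big (fun c : cell la => (val c).1) xpredT) //=.
apply: leq_sum => r _.
pose A := [set c : cell la | ((s c).1 \in J) && (row c == r)].
have -> : (\sum_(c | (c \in [set c | (s c).1 \in J]) && ((val c).1 == r)) 1 = #|A|)%N.
  by rewrite -sum1_card; apply: eq_bigl => c; rewrite !inE -val_eqE.
have leJ : (#|A| <= i)%N.
  rewrite -(@card_in_imset _ _ (fun c => (s c).1) A).
    by apply/subset_leq_card/subsetP => x /imsetP[c]; rewrite inE => /andP[cJ _] ->.
  by move=> v u; rewrite !inE => /andP[_ vr] /andP[_ ur]; apply: (@inj r); rewrite inE.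
have colI : {in A &, injective (fun c : cell la => (val c).2)}.
  move=> v u; rewrite !inE => /andP[_ /eqP vr] /andP[_ /eqP ur] e.
  by apply: cell_inj; rewrite ?vr ?ur // /col e.
rewrite sum1_card.
set B := (X in (_ <= #|X|)%N).
(* Either the first [i] columns all reach row [r], which then allows [minn i (size la)] cells, or
   one of them, [j0], does not, and the whole row lies to its left. *)
have [/forallP full|] := boolP [forall j : 'I_(size la), (j < i)%N ==> (r < nth 0%N la j)%N].
  have BE : #|B| = minn i (size la).
    have -> : #|B| = (\sum_(j < size la | (j < i)%N) 1)%N.
      rewrite -sum1_card; apply: eq_bigl => j; rewrite unfold_in.
      by apply: andb_idr => ji; have /implyP := full j; apply.
    have [ki|ik] := leqP (size la) i.
      rewrite -[RHS]card_ord -sum1_card; apply: eq_bigl => j.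
      by rewrite (leq_trans (ltn_ord j) ki).
    by rewrite -(big_ord_widen (size la) (fun=> 1%N)) 1?ltnW // sum1_card card_ord.
  rewrite BE leq_min leJ -(card_in_imset colI) /=.
  by rewrite -[X in (_ <= X)%N]card_ord max_card.
rewrite negb_forall => /existsP[j0]; rewrite negb_imply -leqNgt => /andP[j0i j0r].
rewrite -(card_in_imset colI); apply/subset_leq_card/subsetP => j /imsetP[c].
rewrite inE => /andP[_ /eqP rc] ->.
have := cellP c; rewrite in_dgE rc => /andP[_ cr]; rewrite unfold_in cr andbT.
apply: ltn_trans j0i; rewrite ltnNge; apply/negP => jc.
have : (nth 0%N la (col c) <= nth 0%N la j0)%N.
  case/andP: pla => srt _.
  by apply: (@sorted_leq_nth _ geq geq_trans leqnn 0%N la srt) => //; rewrite inE ltn_ord.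
by move=> le; have := leq_trans cr (leq_trans le j0r); rewrite ltnn.
Qed.

(** The sum of the [i] largest exponents counts the cells carrying the corresponding absolute
    values, so [non_attacking_count] bounds it. *)
Lemma Csuper_dominated m : m \in msupp (Csuper la N) ->
  mdeg m = sumn la /\ dominated (mpart m) la.
Proof.
rewrite /Csuper sum_fillings //; under eq_bigr do rewrite xmon_grid_of.
move=> /(@msupp_sum_monomials la N (fun s => non_attacking (grid_of s))
  (fun s => (-1) ^+ mneg (grid_of s) * qq ^+ maj (grid_of s) *
     tt_ ^+ (ppos (grid_of s) + quinv (grid_of s))))[s na <-].
rewrite mdeg_content //; split=> //; rewrite /dominated sumn_mpart mdeg_content // eqxx andTb.
apply/allP => i _; set m0 := content s.
have pE : mpart m0 = [seq m0 j | j <- sort (relpre m0 geq) [seq j <- enum 'I_N | (0 < m0 j)%N]].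
  by rewrite /mpart filter_map sort_map.
rewrite pE; set r := sort _ _.
have ur : uniq r by rewrite sort_uniq filter_uniq // enum_uniq.
rewrite -map_take sumnE big_map.
pose J := [set j in take i r].
have uJ : uniq (take i r) by apply: take_uniq.
(* Fewer than [i] absolute values may occur, hence only an inequality. *)
have cJ : (#|J| <= i)%N by rewrite cardsE (card_uniqP uJ) size_take; case: ltnP => // _; lia.
apply: (@leq_trans (sumn (take #|J| la))); last first.
  rewrite !sumn_take [X in (_ <= X)%N]big_mkcond [X in (X <= _)%N]big_mkcond.
  by apply: leq_sum => j _; case: ltnP => // jJ; rewrite (leq_trans jJ cJ).
apply: leq_trans (non_attacking_count J na).
rewrite (big_uniq _ uJ) /= -sum1_card.
rewrite (partition_big (fun c => (s c).1) (mem J)) /=; last by move=> c; rewrite inE.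
rewrite (eq_bigl (mem J)); last by move=> j; rewrite /= inE.
apply: leq_sum => j jJ; rewrite /m0 contentE -sum1_card.
rewrite leq_eqVlt; apply/orP; left; apply/eqP; apply: eq_bigl => c.
by rewrite 2!in_set; apply/esym; apply: andb_idl => /eqP ->.
Qed.

End Plethysm.

(* Symmetric functions of degree |la| are faithfully represented in any *)
(* number N >= |la| of variables; C_lambda[X(t-1)] is computed through  *)
(* (any) expansion of C_lambda in the power sums p_mu, mu |- |la|.       *)
Theorem mainTheorem5 (la : seq nat) (N : nat) :
  is_partition la -> (sumn la <= N)%N ->
  (exists s, psum_expansion (sumn la) s (Cmac la N)) /\
  (forall s, psum_expansion (sumn la) s (Cmac la N) ->
     pleth_tm1 N s = Csuper la N) /\
  (exists c : seq (Qqt * seq nat),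
     all (fun x => is_partition_of (sumn la) x.2 && dominated x.2 la) c /\
     forall s, psum_expansion (sumn la) s (Cmac la N) ->
       pleth_tm1 N s = \sum_(x <- c) x.1 *: msym_part N x.2).
Proof.
move=> pla leN.
have [s0 exp0] : psum_spanned (sumn la) (Cmac la N).
  by apply: sym_psum_spanned; [apply: Cmac_sym | apply: Cmac_homog].
have plE s := @pleth_tm1_Csuper la N pla leN s.
split; first by exists s0.
(* Symmetry of the super sum is inherited from the plethystic power-sum expression. *)
split=> //; have symC : Csuper la N \is symmetric by rewrite -(plE s0 exp0) sym_pleth_tm1.
pose f := Csuper la N; pose P := [seq mpart m | m <- msupp f].
(* The coefficients are read off [Csuper la N], so they do not depend on the power-sum expansion
   chosen. *)
exists [seq (f@_(nth 0%MM (msupp f) (index mu P)), mu) | mu <- undup P]; split.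
  rewrite all_map; apply/allP => mu; rewrite mem_undup => /mapP[m ms ->] /=.
  have [<- ->] := Csuper_dominated pla ms.
  by rewrite is_partition_mpart.
by move=> s /plE ->; rewrite big_map [LHS](sym_msym_part_expansion symC).
Qed.
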